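(* There exists a one-pass streaming algorithm in the adjacency list model which, given access to a perfect heavy edge oracle (as described in the context), uses space $\tilde{O}\big(\min(\epsilon^{-2} m^{2/3}/T^{1/3},\ \epsilon^{-1} m^{1/2})\big)$ and returns a $(1\pm\epsilon)$-approximation to the number $T$ of triangles of the input graph with probability at least $7/10$.
   Context: $G=(V,E)$ is a simple undirected graph with $n=|V|$ vertices, $m=|E|$ edges and $T$ triangles; $0<\epsilon<1$ is the accuracy parameter. Adjacency list model: the stream consists of the adjacency lists of the vertices, each vertex's list arriving contiguously (so each edge appears twice, once in each endpoint's list); $x<_s y$ means the adjacency list of $x$ arrives before that of $y$. For an edge $xy$, $R_{xy}=|\{z:\{x,y,z\}\text{ is a triangle and } x<_s z<_s y\}|$ (so $\sum_{xy\in E}R_{xy}=T$). A perfect heavy edge oracle: for a threshold $\tau$ fixed by the algorithm, when queried on an edge $xy$ seen in the stream it correctly reports HEAVY if $R_{xy}\ge \tau$ and LIGHT otherwise. As is standard, the algorithm is assumed to know a constant-factor approximation of $T$ for setting its parameters. Space is measured in words/edges stored; $\tilde{O}(f)$ denotes $O(f\cdot\mathrm{polylog}(f))$ (polylogarithmic factors, e.g. in $n$, are hidden). *)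

(* Defs.v *)
From HB Require Import structures.
From mathcomp Require Import all_boot all_order all_algebra.
From mathcomp Require Import reals exp.

Set Implicit Arguments.
Unset Strict Implicit.
Unset Printing Implicit Defensive.

Import Order.TTheory GRing.Theory Num.Theory.

Local Open Scope ring_scope.

Record sgraph (n : nat) := SGraph {
  adj : rel 'I_n;
  adj_sym : symmetric adj;
  adj_irr : irreflexive adj }.

Definition edges (n : nat) (G : sgraph n) : {set {set 'I_n}} :=
  [set [set p.1; p.2] | p : 'I_n * 'I_n & adj G p.1 p.2].

Definition triangles (n : nat) (G : sgraph n) : {set {set 'I_n}} :=
  [set A : {set 'I_n} | (#|A| == 3%N) &&
     [forall x in A, forall y in A, (x != y) ==> adj G x y]].

(* Both the order of the lists and the order inside each list are arbitrary. *)
Record adj_stream (n : nat) (G : sgraph n) := AdjStream {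
  list_order : seq 'I_n;
  adj_list : 'I_n -> seq 'I_n;
  list_orderP : perm_eq list_order (enum 'I_n);
  adj_listP : forall v, perm_eq (adj_list v) (enum (adj G v)) }.

(* The item (v, y) is the appearance of the edge vy in the list of v. *)
Definition items (n : nat) (G : sgraph n) (s : adj_stream G) :
    seq ('I_n * 'I_n) :=
  [seq (v, y) | v <- list_order s, y <- adj_list s v].

Definition before (n : nat) (G : sgraph n) (s : adj_stream G) : rel 'I_n :=
  fun x y => (index x (list_order s) < index y (list_order s))%N.

Definition tri_between (n : nat) (G : sgraph n) (s : adj_stream G)
    (x y : 'I_n) : nat :=
  #|[set z | [&& [set x; y; z] \in triangles G, before s x z & before s z y]]|.

(* R_xy is attached to the unordered edge xy; in its definition x is the      *)
(* endpoint whose list arrives first.                                         *)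
Definition edge_R (n : nat) (G : sgraph n) (s : adj_stream G)
    (x y : 'I_n) : nat :=
  if before s x y then tri_between s x y else tri_between s y x.

(* true stands for HEAVY. Nothing is assumed about non-edges. *)
Definition perfect_heavy_oracle (R : realType) (n : nat) (G : sgraph n)
    (s : adj_stream G) (tau : R) (O : rel 'I_n) : Prop :=
  forall x y, adj G x y -> O x y = (tau <= (edge_R s x y)%:R).

(* The memory is a sequence of machine words. On each stream item the memory  *)
(* is updated from its current content, the item, the oracle's answer on the  *)
(* edge of that item, and a fresh random coin. A coin is not available later  *)
(* unless it is stored in memory.                                             *)
Record oracle_streaming_alg (R : realType) (n : nat) := OracleStreamingAlg {
  threshold : R;
  coin : finType;
  coin_law : coin -> R;
  coin_law_ge0 : forall r, 0 <= coin_law r;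
  coin_law_sum1 : \sum_r coin_law r = 1;
  init : seq nat;
  step : seq nat -> 'I_n * 'I_n -> bool -> coin -> seq nat;
  output : seq nat -> R }.

Section Execution.
Variables (R : realType) (n : nat) (A : oracle_streaming_alg R n).
Variables (O : rel 'I_n) (l : seq ('I_n * 'I_n)).

Definition item_step (st : seq nat) (ir : ('I_n * 'I_n) * coin A) : seq nat :=
  step st ir.1 (O ir.1.1 ir.1.2) ir.2.

Definition memories (w : (size l).-tuple (coin A)) : seq (seq nat) :=
  init A :: scanl item_step (init A) (zip l w).

Definition result (w : (size l).-tuple (coin A)) : R :=
  output A (foldl item_step (init A) (zip l w)).

Definition prob (E : pred ((size l).-tuple (coin A))) : R :=
  \sum_(w | E w) \prod_(r <- w) coin_law r.

(* At all times and for all coins, at most S words are stored, each a natural *)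
(* number less than W.                                                        *)
Definition runs_in_space (W : nat) (S : R) : Prop :=
  forall w st, st \in memories w ->
    all (fun x => (x < W)%N) st /\ (size st)%:R <= S.

End Execution.

(* min(eps^-2 m^(2/3) / T^(1/3), eps^-1 m^(1/2)), the first term being read   *)
(* as +oo when T = 0.                                                         *)
Definition space_bound (R : realType) (eps : R) (m T : nat) : R :=
  if T == 0%N then eps^-1 * m%:R `^ (1 / 2)
  else Num.min (eps ^- 2 * (m%:R `^ (2 / 3) / T%:R `^ (1 / 3)))
               (eps^-1 * m%:R `^ (1 / 2)).

(* The polylogarithmic factors are those in f and in n. *)
Definition soft_O (R : realType) (C : R) (k n : nat) (f : R) : R :=
  C * f * (1 + ln (1 + n%:R + f)) ^+ k.

(* Main.v *)
(* Write R_e for the number of triangles whose first and last vertex, in stream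
   order, are the ends of e; the R_e add up to T. When a -> y is the first
   appearance of an edge, storing it suffices to compute R_ay exactly, since the
   list of every z between a and y shows whether z sees both ends.
   Light edges are sampled at rate p3; their R_e are below the threshold tau, so
   the variance is at most tau T / p3. Heavy edges are few, and sampled at the
   larger rate p2; this is accurate only for those with R_e below some tau2. For
   an edge with larger R_ay one uses Q, the number of z between a and y whose
   edge az was sampled at rate p3: Q / p3 estimates R_ay with small relative
   error. The oracle has a single threshold, so the choice between the two
   heavy estimators is made from Q itself (Q / p3 >= tau2); an edge on the wrong
   side of tau2 needs a large deviation of Q, and Chebyshev bounds its expected
   contribution. Altogether E|error| <= 4 eta T with eta = eps / 40, and no
   logarithmic factor is lost.
   With q = min(2 m^(2/3) / (eta^2 t^(1/3)), m^(1/2) / eta) and t = T0 / c, the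
   rates p3 = q / m, p2 = eta^2 q^2 / m and the thresholds tau = eta^2 t q / m,
   tau2 = 2 m / (eta^2 q) balance the three errors and keep O(q) edges on
   average; the algorithm gives up when it holds ten times more. *)

Require Import Defs.
From HB Require Import structures.
From mathcomp Require Import all_boot all_order all_algebra.
From mathcomp Require Import reals exp.
From mathcomp Require Import zify ring lra.

Set Implicit Arguments.
Unset Strict Implicit.
Unset Printing Implicit Defensive.

Import Order.TTheory GRing.Theory Num.Theory.

Local Open Scope ring_scope.

(** * Second moments of Bernoulli samples *)

Section Bernoulli.
Variables (R : realType) (I : finType) (p : R).
Hypotheses (p_gt0 : 0 < p) (p_le1 : p <= 1).
Implicit Types F : {ffun I -> bool} -> R.

Definition bern (b : bool) : R := if b then p else 1 - p.

Definition bexp F : R := \sum_(x : {ffun I -> bool}) (\prod_i bern (x i)) * F x.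

Lemma bern_ge0 b : 0 <= bern b.
Proof. by rewrite /bern; case: b; rewrite ?subr_ge0 // ltW. Qed.

Lemma bexp_eq F F' : F =1 F' -> bexp F = bexp F'.
Proof. by move=> eqF; apply: eq_bigr => x _; rewrite eqF. Qed.

Lemma bexp_le F F' : (forall x, F x <= F' x) -> bexp F <= bexp F'.
Proof.
move=> leF; apply: ler_sum => x _; apply: ler_wpM2l (leF x).
by apply: prodr_ge0 => i _; apply: bern_ge0.
Qed.

Lemma bexpD F F' : bexp (fun x => F x + F' x) = bexp F + bexp F'.
Proof. by rewrite -big_split; apply: eq_bigr => x _; rewrite mulrDr. Qed.

Lemma bexpZ a F : bexp (fun x => a * F x) = a * bexp F.
Proof. by rewrite mulr_sumr; apply: eq_bigr => x _; rewrite mulrCA. Qed.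

Lemma bexp_sum (J : finType) (P : pred J) (F : J -> {ffun I -> bool} -> R) :
  bexp (fun x => \sum_(j | P j) F j x) = \sum_(j | P j) bexp (F j).
Proof.
by rewrite exchange_big; apply: eq_bigr => x _; rewrite mulr_sumr.
Qed.

(** Independence: expanding the product of two-term sums gives one summand per outcome [x].
    Functions of one or two coordinates are treated by setting the other factors to 1. *)
Lemma bexp_prod (h : I -> bool -> R) :
  bexp (fun x => \prod_i h i (x i)) =
  \prod_i (p * h i true + (1 - p) * h i false).
Proof.
under [RHS]eq_bigr => i _.
  have -> : p * h i true + (1 - p) * h i false = \sum_b bern b * h i b.
    by rewrite big_bool.
over.
rewrite bigA_distr_bigA; apply: eq_bigr => x _.
by rewrite -big_split.
Qed.

Lemma bexp_cst a : bexp (fun=> a) = a.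
Proof.
have -> : bexp (fun=> a) = bexp (fun x => a * \prod_i (fun=> fun=> 1) i (x i)).
  by apply: bexp_eq => x; rewrite big1 ?mulr1.
rewrite bexpZ (bexp_prod (fun=> fun=> 1)) big1 ?mulr1 // => i _; lra.
Qed.

Lemma bexp_coord i (f : bool -> R) :
  bexp (fun x => f (x i)) = p * f true + (1 - p) * f false.
Proof.
pose h k b := if k == i then f b else 1.
have -> : bexp (fun x => f (x i)) = bexp (fun x => \prod_k h k (x k)).
  apply: bexp_eq => x; rewrite (bigD1 i) //= big1 /h ?eqxx ?mulr1 // => k.
  by move=> /negPf->.
rewrite (bexp_prod h) (bigD1 i) //= big1 /h ?eqxx ?mulr1 // => k /negPf->; lra.
Qed.

Lemma bexp_coord2 i j (f g : bool -> R) : i != j ->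
  bexp (fun x => f (x i) * g (x j)) =
  (p * f true + (1 - p) * f false) * (p * g true + (1 - p) * g false).
Proof.
move=> ij; have ji : j != i by rewrite eq_sym.
pose h k b := if k == i then f b else if k == j then g b else 1.
have -> : bexp (fun x => f (x i) * g (x j)) = bexp (fun x => \prod_k h k (x k)).
  apply: bexp_eq => x; rewrite (bigD1 i) //= (bigD1 j) //= big1 => [|k].
    by rewrite /h !eqxx (negPf ji) mulr1.
  by rewrite /h => /andP[/negPf-> /negPf->].
rewrite (bexp_prod h) (bigD1 i) //= (bigD1 j) //= big1 => [|k].
  by rewrite /h !eqxx (negPf ji) mulr1.
by rewrite /h => /andP[/negPf-> /negPf->]; lra.
Qed.

(** Error of the unbiased weight [b / p] given to a unit sampled at rate [p]: mean 0, variance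
    [p^-1 - 1]. *)
Definition centred (b : bool) : R := b%:R / p - 1.

(** Distinct coordinates are independent with mean 0, so the cross terms of the expanded square
    vanish. *)
Lemma bexp_centred_sq (P : pred I) (a : I -> R) :
  bexp (fun x => (\sum_(i | P i) a i * centred (x i)) ^+ 2) =
  \sum_(i | P i) a i ^+ 2 * (p^-1 - 1).
Proof.
have p0 : p != 0 by rewrite gt_eqF.
have -> : bexp (fun x => (\sum_(i | P i) a i * centred (x i)) ^+ 2) =
   \sum_(i | P i) \sum_(j | P j)
      bexp (fun x => a i * a j * (centred (x i) * centred (x j))).
  under [RHS]eq_bigr => i _ do rewrite -bexp_sum.
  rewrite -bexp_sum; apply: bexp_eq => x; rewrite expr2 mulr_suml.
  apply: eq_bigr => i _; rewrite mulr_sumr; apply: eq_bigr => j _; ring.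
apply: eq_bigr => i Pi; rewrite (bigD1 i) //= big1 ?addr0 => [|j /andP[_ ji]].
  rewrite bexpZ (bexp_coord i (fun b => centred b * centred b)) /centred /=.
  by rewrite -expr2; field.
rewrite bexpZ bexp_coord2 1?eq_sym // /centred /=.
by rewrite !mul0r !sub0r; field.
Qed.

(** Pointwise AM-GM, [|F| <= F^2 / (2 lam) + lam / 2], takes the place of the Cauchy-Schwarz
    inequality. *)
Lemma bexp_abs_le F (lam : R) : 0 < lam -> bexp (fun x => F x ^+ 2) <= lam ^+ 2 ->
  bexp (fun x => `|F x|) <= lam.
Proof.
move=> lam0 le2.
have : bexp (fun x => `|F x|) <=
       bexp (fun x => (2 * lam)^-1 * F x ^+ 2 + lam / 2).
  apply: bexp_le => x; rewrite -(real_normK (num_real (F x))).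
  have l2 : 0 < 2 * lam by lra.
  have -> : (2 * lam)^-1 * `|F x| ^+ 2 + lam / 2 =
            (`|F x| ^+ 2 + lam ^+ 2) / (2 * lam) by field; rewrite gt_eqF.
  rewrite ler_pdivlMr // -subr_ge0.
  by rewrite (_ : _ - _ = (`|F x| - lam) ^+ 2) ?sqr_ge0 //; ring.
rewrite bexpD bexp_cst (bexpZ _ (fun x => F x ^+ 2)) => /le_trans; apply.
have le3 : (2 * lam)^-1 * bexp (fun x => F x ^+ 2) <= lam / 2.
  rewrite ler_pdivrMl; last by lra.
  by rewrite (_ : _ * (_ / 2) = lam ^+ 2) //; field.
apply: le_trans (lerD le3 (lexx _)) _; lra.
Qed.

End Bernoulli.

(** * Mean absolute error of the estimator *)

Section Estimator.
Variables (R : realType) (I : finType) (p2 p3 tau tau2 eta : R).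
Hypotheses (p2_gt0 : 0 < p2) (p2_le1 : p2 <= 1).
Hypotheses (p3_gt0 : 0 < p3) (p3_le1 : p3 <= 1).
Variables (L H : pred I) (r : I -> nat) (S : I -> {set I}).
Hypothesis card_S : forall i, H i -> #|S i| = r i.

Definition hits (y : {ffun I -> bool}) i : nat := #|[set j in S i | y j]|.

Definition big_hits (k : nat) : bool := tau2 * p3 <= k%:R.

(** The coins [y], of rate [p3], serve both the light items and the hits; the coins [x], of rate
    [p2], serve the heavy items with few hits. Which heavy items those are depends on [y] alone. *)
Definition estimate (x y : {ffun I -> bool}) : R :=
  \sum_(i | L i) (r i)%:R * (y i)%:R / p3 +
  \sum_(i | H i) (if big_hits (hits y i) then (hits y i)%:R / p3
                  else (r i)%:R * (x i)%:R / p2).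

Let T : R := \sum_(i | L i) (r i)%:R + \sum_(i | H i) (r i)%:R.

Hypotheses (T_gt0 : 0 < T) (tau2_gt0 : 0 < tau2).
Hypotheses (eta_gt0 : 0 < eta) (eta_le : eta <= 1 / 2).
Hypothesis light_le : forall i, L i -> (r i)%:R <= tau.
Hypothesis light_var : tau * (p3^-1 - 1) <= eta ^+ 2 * T.
Hypothesis aux_var : p3^-1 - 1 <= eta ^+ 2 * tau2 / 2.
Hypothesis medium_var : 2 * tau2 * (p2^-1 - 1) <= eta ^+ 2 * T.

Let dev (y : {ffun I -> bool}) i : R := \sum_(j | j \in S i) 1 * centred p3 (y j).

Let devE y i : H i -> dev y i = (hits y i)%:R / p3 - (r i)%:R.
Proof.
move=> Hi; rewrite /dev /hits -(card_S Hi) -sum1_card -[#|_|]sum1_card.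
rewrite !natr_sum mulr_suml (big_mkcond (mem (S i))) /=.
rewrite [X in X - _]big_mkcond [X in _ - X]big_mkcond -sumrB /=.
apply: eq_bigr => j _; rewrite inE /centred.
by case: (j \in S i); case: (y j) => /=; rewrite ?mul1r ?mul0r ?subr0.
Qed.

Let p3V_ge0 : 0 <= p3^-1 - 1.
Proof. by rewrite subr_ge0 invf_ge1. Qed.

Let p2V_ge0 : 0 <= p2^-1 - 1.
Proof. by rewrite subr_ge0 invf_ge1. Qed.

Let dev_sq i : H i ->
  bexp p3 (fun y => dev y i ^+ 2) = (r i)%:R * (p3^-1 - 1).
Proof.
move=> Hi; rewrite (bexp_centred_sq p3_gt0 (mem (S i)) (fun=> 1)).
by rewrite sumr_const /= card_S // expr1n mul1r mulr_natl.
Qed.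

(** If [r >= tau2 / 2], the variance [r (1/p3 - 1)] is at most [(eta r)^2] by [aux_var]. If
    [r < tau2 / 2], having many hits forces a deviation of at least [tau2 / 2], so that
    [|dev| <= (2 / tau2) dev^2], whose mean is at most [eta^2 r]. *)
Let heavy_dev i : H i ->
  bexp p3 (fun y => if big_hits (hits y i) then `|dev y i| else 0)
    <= eta * (r i)%:R.
Proof.
have t2 := tau2_gt0; have e0 := eta_gt0; have e1 := eta_le; have av := aux_var.
move=> Hi; have r0 : 0 <= (r i)%:R :> R by apply: ler0n.
have [le_r|lt_r] := leP (tau2 / 2) (r i)%:R.
  have r1 : 0 < (r i)%:R :> R by lra.
  apply: le_trans (_ : bexp p3 (fun y => `|dev y i|) <= _).
    by apply: bexp_le => // y; case: ifP.
  apply: bexp_abs_le => //; first by rewrite mulr_gt0.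
  rewrite dev_sq //.
  have := ler_wpM2l r0 av.
  have : 0 <= (r i)%:R * eta ^+ 2 * ((r i)%:R - tau2 / 2).
    by apply: mulr_ge0; [apply: mulr_ge0 => //; exact: sqr_ge0 | lra].
  move: (r i)%:R (p3^-1 - 1) => a b; nra.
apply: le_trans (_ : bexp p3 (fun y => (2 / tau2) * dev y i ^+ 2) <= _).
  apply: bexp_le => // y; case: ifP => [big|_].
    have le1 : tau2 <= (hits y i)%:R / p3 by rewrite ler_pdivlMr.
    rewrite devE // ger0_norm; last by lra.
    rewrite mulrAC ler_pdivlMr //; move: ((hits y i)%:R / p3) le1 => a le1; nra.
  by rewrite mulr_ge0 ?sqr_ge0 ?divr_ge0 // ltW.
rewrite (bexpZ _ _ (fun y => dev y i ^+ 2)) dev_sq // mulrAC ler_pdivrMr //.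
have := ler_wpM2l r0 av.
have : 0 <= (r i)%:R * (eta - eta ^+ 2) * tau2.
  by apply: mulr_ge0; [apply: mulr_ge0 => //; nra | exact: ltW].
move: (r i)%:R (p3^-1 - 1) => a b; nra.
Qed.

(** Few hits mean an estimate below [tau2 < r / 2], hence [dev^2 > r^2 / 4]. The mean error over [x]
    is at most [2 r], thus at most [(8 / r) dev^2], whose mean is at most
    [4 eta^2 tau2 <= 2 eta^2 r <= eta r]. *)
Let heavy_misclassified i : H i -> 2 * tau2 < (r i)%:R ->
  bexp p3 (fun y => bexp p2 (fun x =>
    if big_hits (hits y i) then 0 else `|(r i)%:R * centred p2 (x i)|))
    <= eta * (r i)%:R.
Proof.
have t2 := tau2_gt0; have e0 := eta_gt0; have e1 := eta_le; have av := aux_var.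
have p20 := p2_gt0; have p21 := p2_le1.
move=> Hi lt_r; have r0 : 0 < (r i)%:R :> R by lra.
apply: le_trans (_ : bexp p3 (fun y => (8 / (r i)%:R) * dev y i ^+ 2) <= _).
  apply: bexp_le => // y; case big: (big_hits (hits y i)).
    by rewrite bexp_cst mulr_ge0 ?sqr_ge0 // divr_ge0 // ltW.
  move/negbT: big; rewrite -ltNge => small.
  have lt1 : (hits y i)%:R / p3 < tau2 by rewrite ltr_pdivrMr.
  rewrite (bexp_coord p2 i (fun b => `|(r i)%:R * centred p2 b|)) /centred /=.
  rewrite !normrM !(ger0_norm (ltW r0)) mul1r (ger0_norm p2V_ge0).
  rewrite mul0r sub0r normrN1 mulr1.
  apply: le_trans (_ : 2 * (r i)%:R <= _).
    have -> : p2 * ((r i)%:R * (p2^-1 - 1)) + (1 - p2) * (r i)%:R =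
       2 * (1 - p2) * (r i)%:R by field; rewrite gt_eqF.
    by apply: ler_wpM2r; [exact: ltW | lra].
  rewrite devE // mulrAC ler_pdivlMr //.
  move: ((hits y i)%:R / p3) (r i)%:R r0 lt_r lt1 => a b *; nra.
rewrite (bexpZ _ _ (fun y => dev y i ^+ 2)) dev_sq //.
rewrite mulrA divfK ?gt_eqF //.
move: (r i)%:R (p3^-1 - 1) av lt_r => a b h1 h2.
have : 0 <= eta ^+ 2 * (a - 2 * tau2) by apply: mulr_ge0; [exact: sqr_ge0 | lra].
have : 0 <= eta * a * (1 - 2 * eta) by apply: mulr_ge0; [apply: mulr_ge0|]; lra.
nra.
Qed.

Let sum_light_le : \sum_(i | L i) (r i)%:R <= T.
Proof. by rewrite /T lerDl sumr_ge0 // => i _; exact: ler0n. Qed.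

Let sum_heavy_le (P : pred I) : \sum_(i | H i && P i) (r i)%:R <= T.
Proof.
rewrite /T (bigID P H) /= addrCA lerDl addr_ge0 // sumr_ge0 // => i _; exact: ler0n.
Qed.

Let scaled_le (a : R) : a <= T -> a * (eta ^+ 2 * T) <= (eta * T) ^+ 2.
Proof.
move=> leaT; have -> : (eta * T) ^+ 2 = T * (eta ^+ 2 * T) by ring.
by apply: ler_wpM2r leaT; rewrite mulr_ge0 ?sqr_ge0 // ltW.
Qed.

(** The error splits into four sums, each of mean at most [eta T]: light items ([A]), heavy items
    with many hits ([B]), and heavy items with few hits, either rightly so ([C], [r <= 2 tau2]) or
    by a large deviation of the hits ([D]). *)
Lemma estimate_error :
  bexp p3 (fun y => bexp p2 (fun x => `|estimate x y - T|)) <= 4 * eta * T.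
Proof.
pose small i : bool := (r i)%:R <= 2 * tau2.
pose A (y : {ffun I -> bool}) := \sum_(i | L i) (r i)%:R * centred p3 (y i).
pose B (y : {ffun I -> bool}) i :=
  if big_hits (hits y i) then `|dev y i| else 0.
pose c (y : {ffun I -> bool}) i : R := if big_hits (hits y i) then 0 else (r i)%:R.
pose C (x y : {ffun I -> bool}) :=
  \sum_(i | H i && small i) c y i * centred p2 (x i).
pose D i (y x : {ffun I -> bool}) :=
  if big_hits (hits y i) then 0 else `|(r i)%:R * centred p2 (x i)|.
have ptw x y : `|estimate x y - T| <= (`|A y| + \sum_(i | H i) B y i) +
    (`|C x y| + \sum_(i | H i && ~~ small i) D i y x).
  have -> : estimate x y - T = A y +
     (\sum_(i | H i && small i) c y i * centred p2 (x i)
     + \sum_(i | H i && ~~ small i) c y i * centred p2 (x i)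
     + \sum_(i | H i) (if big_hits (hits y i) then dev y i else 0)).
    rewrite /estimate /T opprD addrACA -!sumrB; congr (_ + _).
      by apply: eq_bigr => i _; rewrite /centred mulrBr mulr1 mulrA.
    rewrite -bigID -big_split /=; apply: eq_bigr => i Hi; rewrite /c devE //.
    by case: ifP => _; rewrite ?mul0r ?add0r // addr0 /centred mulrBr mulr1 mulrA.
  rewrite -[in leRHS]addrA; apply: le_trans (ler_normD _ _) _.
  rewrite lerD2l [leRHS]addrC; apply: le_trans (ler_normD _ _) _; apply: lerD.
    apply: le_trans (ler_normD _ _) _; rewrite lerD2l.
    apply: le_trans (ler_norm_sum _ _ _) _; apply: ler_sum => i _.
    by rewrite /D /c; case: ifP => _; rewrite ?mul0r ?normr0.
  apply: le_trans (ler_norm_sum _ _ _) _; apply: ler_sum => i _.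
  by rewrite /B; case: ifP; rewrite ?normr0.
(* Once [y] is fixed, the coefficients [c y i] of [C] are constants, so its second moment over [x]
   alone is enough. *)
apply: le_trans (_ : bexp p3 (fun y => (`|A y| + \sum_(i | H i) B y i) +
    (eta * T + \sum_(i | H i && ~~ small i) bexp p2 (D i y))) <= _).
  apply: bexp_le => // y.
  apply: le_trans (bexp_le p2_gt0 p2_le1 (fun x => ptw x y)) _.
  rewrite bexpD bexp_cst // lerD2l bexpD bexp_sum lerD2r.
  apply: bexp_abs_le; rewrite ?mulr_gt0 // /C bexp_centred_sq //.
  apply: le_trans (_ : \sum_(i | H i && small i) (r i)%:R * (eta ^+ 2 * T) <= _).
    apply: ler_sum => i /andP[_ sm].
    apply: le_trans (_ : (r i)%:R * (2 * tau2 * (p2^-1 - 1)) <= _).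
      rewrite mulrA; apply: ler_wpM2r => //.
      rewrite /c; case: ifP => _; first by rewrite expr0n /= !mulr_ge0 // ltW.
      by rewrite expr2; apply: ler_wpM2l.
    by apply: ler_wpM2l.
  by rewrite -mulr_suml; apply: scaled_le.
have hA : bexp p3 (fun y => `|A y|) <= eta * T.
  apply: bexp_abs_le; rewrite ?mulr_gt0 // /A bexp_centred_sq //.
  apply: le_trans (_ : \sum_(i | L i) (r i)%:R * (eta ^+ 2 * T) <= _).
    apply: ler_sum => i Li.
    apply: le_trans (_ : (r i)%:R * (tau * (p3^-1 - 1)) <= _).
      by rewrite mulrA; apply: ler_wpM2r => //; rewrite expr2 ler_wpM2l ?light_le.
    by apply: ler_wpM2l.
  by rewrite -mulr_suml; apply: scaled_le.
rewrite bexpD [X in X + _]bexpD [X in _ + X]bexpD bexp_cst // !bexp_sum.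
have hB : \sum_(i | H i) bexp p3 (B^~ i) <= eta * T.
  apply: le_trans (_ : \sum_(i | H i) eta * (r i)%:R <= _).
    by apply: ler_sum => i Hi; apply: heavy_dev.
  rewrite -mulr_sumr ler_pM2l //.
  by have := sum_heavy_le xpredT; under eq_bigl => i do rewrite andbT.
have hD : \sum_(i | H i && ~~ small i) bexp p3 (fun y => bexp p2 (D i y)) <= eta * T.
  apply: le_trans (_ : \sum_(i | H i && ~~ small i) eta * (r i)%:R <= _).
    apply: ler_sum => i /andP[Hi sm]; apply: heavy_misclassified => //.
    by rewrite ltNge.
  by rewrite -mulr_sumr ler_pM2l.
lra.
Qed.

End Estimator.

Local Open Scope nat_scope.

(** * The streaming algorithm *)

(* An entry is a stored directed edge src -> dst, created in the list of src.
   last_src and last_dst are the last vertices whose lists contained src and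
   dst since then (n if there is none), src_heavy the oracle's answer when src
   was last met, common the number of lists containing both. An edge is also
   stored at its second appearance, when dst comes first: the algorithm cannot
   tell the two apart, but dst_seen then remains false and the list of dst never
   comes again, so that such an entry contributes nothing. *)
Record entry := Entry {
  src : nat; dst : nat; last_src : nat; last_dst : nat;
  src_heavy : bool; dst_seen : bool; common : nat;
  heavy : bool; coin_m : bool; coin_a : bool }.

Definition encode_entry (e : entry) : seq nat :=
  [:: src e; dst e; last_src e; last_dst e; src_heavy e : nat; dst_seen e : nat;
      common e; heavy e : nat; coin_m e : nat; coin_a e : nat].

Definition decode_entry (s : seq nat) : entry :=
  Entry (nth 0 s 0) (nth 0 s 1) (nth 0 s 2) (nth 0 s 3)
        (nth 0 s 4 != 0) (nth 0 s 5 != 0) (nth 0 s 6)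
        (nth 0 s 7 != 0) (nth 0 s 8 != 0) (nth 0 s 9 != 0).

Lemma encode_entryK : cancel encode_entry decode_entry.
Proof. by case=> ? ? ? ? [] [] ? [] [] []. Qed.

HB.instance Definition _ := Equality.copy entry (can_type encode_entryK).

(* acc1 and acc2 collect the two parts of the output, to be divided by p3 and
   p2; base1 and base2 are their values before the current list. The gains of
   the current list are recomputed at each of its items, because the end of a
   list cannot be detected. *)
Record state := State {
  current : nat; base1 : nat; acc1 : nat; base2 : nat; acc2 : nat;
  entries : seq entry }.

Definition encode (st : state) : seq nat :=
  [:: current st; base1 st; acc1 st; base2 st; acc2 st]
    ++ flatten (map encode_entry (entries st)).

Definition decode (s : seq nat) : state :=
  State (nth 0 s 0) (nth 0 s 1) (nth 0 s 2) (nth 0 s 3) (nth 0 s 4)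
    (map decode_entry (reshape (nseq ((size s - 5) %/ 10) 10) (drop 5 s))).

Lemma shape_encode D : shape (map encode_entry D) = nseq (size D) 10.
Proof. by elim: D => //= e D ->. Qed.

Lemma size_encode st : size (encode st) = 5 + 10 * size (entries st).
Proof.
by rewrite /encode size_cat size_flatten shape_encode sumn_nseq mulnC.
Qed.

Lemma encodeK : cancel encode decode.
Proof.
case=> c b1 a1 b2 a2 D; rewrite /decode size_encode /= addKn mulKn //.
by rewrite drop0 -shape_encode flattenK mapK //; exact: encode_entryK.
Qed.

Section Algorithm.
Variables (n : nat) (big : pred nat).

Definition fresh (v u : nat) (b : bool) (c : bool * bool) : entry :=
  Entry v u n n false false 0 b c.1 c.2.

(** The coin [c.2] has rate [p3] and keeps any item; [c.1] has rate [p2] and keeps heavy items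
    only. *)
Definition kept (b : bool) (c : bool * bool) : bool := c.2 || b && c.1.

(** [common] grows at the second endpoint met in the list of [v], in whichever order the two come;
    requiring [u] to be an endpoint prevents a later item of the same list from counting again. *)
Definition update (v u : nat) (b : bool) (e : entry) : entry :=
  let ls := if u == src e then v else last_src e in
  let ld := if u == dst e then v else last_dst e in
  Entry (src e) (dst e) ls ld
    (if u == src e then b else src_heavy e)
    (dst_seen e || (dst e == v) && (u == src e))
    (common e + [&& (u == src e) || (u == dst e), ls == v & ld == v])
    (heavy e) (coin_m e) (coin_a e).

Definition advance (D : seq entry) (v u : nat) (b : bool) (c : bool * bool) :=
  map (update v u b) D ++ (if kept b c then [:: fresh v u b c] else [::]).

(** The quantity Q for the edge [av], read off the stored edges [az]: the edge [av] itself need not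
    be stored. [src_heavy] holds the oracle's answer on [av], obtained at the item [(v, a)]; if [av]
    is light, the count is 0. *)
Definition aux_hits (D : seq entry) (a v : nat) : nat :=
  count (fun e => [&& src e == a, coin_a e, dst_seen e, last_src e == v,
                      last_dst e == v & src_heavy e]) D.

Definition if_big (k : nat) : nat := if big k then k else 0.

Definition gain1 (D : seq entry) (v : nat) : nat :=
  \sum_(e <- D | [&& dst e == v, ~~ heavy e & coin_a e]) common e +
  \sum_(a < n) if_big (aux_hits D a v).

Definition gain2 (D : seq entry) (v : nat) : nat :=
  \sum_(e <- D | [&& dst e == v, heavy e, coin_m e
                   & ~~ big (aux_hits D (src e) v)]) common e.

Definition next_state (st : state) (p : 'I_n * 'I_n) (b : bool) (c : bool * bool) :=
  let v := p.1 : nat in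
  let D := advance (entries st) v p.2 b c in
  let b1 := if current st == v then base1 st else acc1 st in
  let b2 := if current st == v then base2 st else acc2 st in
  State v b1 (b1 + gain1 D v) b2 (b2 + gain2 D v) D.

(** No vertex has value [n], so the first item always opens a new list. *)
Definition start : state := State n 0 0 0 0 [::].

(** * Effect of one adjacency list on the state *)

Section Run.
Variables (O : rel 'I_n) (coins : 'I_n * 'I_n -> bool * bool).

Definition run (st : state) (l : seq ('I_n * 'I_n)) : state :=
  foldl (fun st p => next_state st p (O p.1 p.2) (coins p)) st l.

Definition kept_item (p : 'I_n * 'I_n) : bool := kept (O p.1 p.2) (coins p).

Definition fresh_item (p : 'I_n * 'I_n) : entry :=
  fresh p.1 p.2 (O p.1 p.2) (coins p).

Definition scan (v : 'I_n) (us : seq 'I_n) (e : entry) : entry :=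
  foldl (fun e (u : 'I_n) => update v u (O v u) e) e us.

Lemma scan_cons (v u : 'I_n) us e :
  scan v (u :: us) e = scan v us (update v u (O v u) e).
Proof. by []. Qed.

(** The last two hypotheses are the loop invariant: an endpoint already met in the list of [v] does
    not occur in the rest of it. They hold vacuously when the list begins, as both stamps then
    differ from [v]. *)
Lemma scan_entry (v : 'I_n) us (a z : 'I_n) (l1 l2 : nat) h c k f x y :
  uniq us -> a != z -> (l1 == v -> a \notin us) -> (l2 == v -> z \notin us) ->
  scan v us (Entry a z l1 l2 h c k f x y) =
  Entry a z (if a \in us then v : nat else l1) (if z \in us then v : nat else l2)
    (if a \in us then O v a else h) (c || (z == v) && (a \in us))
    (k + ((a \in us) && ((z \in us) || (l2 == v)) || (z \in us) && (l1 == v)))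
    f x y.
Proof.
move=> + az; elim: us l1 l2 h c k => [|u us IH] l1 l2 h c k.
  by rewrite !in_nil /= andbF orbF addn0.
rewrite cons_uniq => /andP[uus uniq_us] h1 h2.
rewrite scan_cons /update /= IH //; first last.
- rewrite val_eqE; have [<-|_] := eqVneq u z; first by [].
  by move=> /h2; rewrite inE negb_or => /andP[].
- rewrite val_eqE; have [<-|_] := eqVneq u a; first by [].
  by move=> /h1; rewrite inE negb_or => /andP[].
rewrite !inE !val_eqE; have [eq_ua|ne_ua] := eqVneq u a.
  subst u; have -> : (l1 == v) = false.
    by apply/negbTE/negP => /h1; rewrite inE eqxx.
  rewrite (negPf uus) (negPf az) (eq_sym z a) (negPf az) !eqxx /=.
  rewrite !andbF !orbF !andbT; congr Entry; rewrite -addnA; congr addn.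
  move: h2; rewrite inE negb_or.
  by case: (l2 == v) => [/(_ isT)/andP[_ /negPf->]|_]; rewrite ?orbF ?add0n.
rewrite /= andbF orbF.
have [eq_uz|ne_uz] := eqVneq u z.
  subst u; have -> : (l2 == v) = false.
    by apply/negbTE/negP => /h2; rewrite inE eqxx.
  rewrite (negPf uus) !eqxx /= !andbT !orbF; congr Entry.
  rewrite -addnA; congr addn; move: h1; rewrite inE negb_or.
  by case: (l1 == v) => [/(_ isT)/andP[_ /negPf->]|_]; rewrite ?andbT ?orbF.
by rewrite /= addn0.
Qed.

Definition collect (D : seq entry) (v : 'I_n) (us : seq 'I_n) : seq entry :=
  foldl (fun D (u : 'I_n) => advance D v u (O v u) (coins (v, u))) D us.

Lemma update_fresh (v u u' : 'I_n) b : u != v -> u != u' ->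
  update v u b (fresh_item (v, u')) = fresh_item (v, u').
Proof.
by rewrite /update /= !val_eqE => /negPf-> /negPf->; rewrite andbF.
Qed.

(** Entries created in the list of [v] are left unchanged by the rest of it: a later neighbour is
    neither [v] nor the same neighbour again. *)
Lemma collectE D (v : 'I_n) us : uniq us -> v \notin us ->
  collect D v us = map (scan v us) D ++
    [seq fresh_item p | p <- [seq (v, u) | u <- us] & kept_item p].
Proof.
elim/last_ind: us => [|us u IH]; first by rewrite /= cats0 map_id.
rewrite rcons_uniq mem_rcons inE negb_or => /andP[uus uniq_us] /andP[vu vus].
rewrite /collect foldl_rcons -/(collect D v us) IH // /advance map_cat -catA.
rewrite -map_comp; congr (_ ++ _).
  by apply: eq_map => e; rewrite /scan foldl_rcons.
rewrite map_rcons filter_rcons -/(kept_item (v, u)).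
have -> : [seq update v u (O v u) i | i <- [seq fresh_item p
      | p <- [seq (v, u0) | u0 <- us] & kept_item p]] =
   [seq fresh_item p | p <- [seq (v, u0) | u0 <- us] & kept_item p].
  rewrite -map_comp; apply/eq_in_map => p; rewrite mem_filter => /andP[_].
  case/mapP => u' u'us ->; apply: update_fresh; first by rewrite eq_sym.
  by apply: contraNneq uus => ->.
by rewrite /kept_item; case: ifP => _; rewrite ?cats0 // map_rcons cats1.
Qed.

(** The base values are frozen at the first item of the list and each item overwrites the previous
    gains, so only the gains computed at the last item survive. *)
Lemma run_block st (v : 'I_n) us : current st != v -> us != [::] ->
  run st [seq (v, u) | u <- us] =
  let D := collect (entries st) v us in
  State v (acc1 st) (acc1 st + gain1 D v) (acc2 st) (acc2 st + gain2 D v) D.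
Proof.
move=> cur_v; elim/last_ind: us => // us u IH _.
rewrite map_rcons /run foldl_rcons -/(run st _) /collect foldl_rcons.
rewrite -/(collect _ v us); case: (eqVneq us [::]) => [->|/IH->].
  by rewrite /next_state /= (negPf cur_v).
by rewrite /next_state /= eqxx.
Qed.

Lemma size_entries_run st l :
  size (entries (run st l)) = size (entries st) + count kept_item l.
Proof.
elim/last_ind: l => [|l p IH]; first by rewrite addn0.
rewrite /run foldl_rcons -/(run st l) /= size_cat size_map IH.
by rewrite -cats1 count_cat /= addnA addn0 /kept_item; case: ifP.
Qed.

(** * Size of the stored numbers *)

Definition small_entry (t : nat) (e : entry) : bool :=
  [&& src e <= n, dst e <= n, last_src e <= n, last_dst e <= n & common e <= t].

(** Here [t] is the number of items read and [B] bounds the gain that one item can add to an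
    accumulator. *)
Definition small_state (t B : nat) (st : state) : bool :=
  [&& all (small_entry t) (entries st), size (entries st) <= t, current st <= n &
      all (geq (t * B)) [:: base1 st; acc1 st; base2 st; acc2 st]].

Lemma sum_common_le t D P : all (small_entry t) D ->
  \sum_(e <- D | P e) common e <= size D * t.
Proof.
move=> /allP smallD; rewrite big_mkcond -sum1_size big_distrl /= !big_seq.
by apply: leq_sum => e /smallD/and5P[_ _ _ _ le_c]; case: ifP; rewrite ?mul1n.
Qed.

Lemma gain1_le t D v : all (small_entry t) D -> gain1 D v <= size D * t + n * size D.
Proof.
move=> smallD; apply: leq_add; first exact: sum_common_le.
rewrite -[X in _ <= X * _]card_ord -sum_nat_const; apply: leq_sum => a _.
by rewrite /if_big; case: ifP => // _; apply: count_size.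
Qed.

Lemma small_next_state t B st p b c : t.+1 * t.+1 + n * t.+1 <= B ->
  small_state t B st -> small_state t.+1 B (next_state st p b c).
Proof.
move=> leB /and4P[smallD size_D cur_n /= /and5P[lb1 la1 lb2 la2 _]].
have smallD' : all (small_entry t.+1) (entries (next_state st p b c)).
  rewrite /= all_cat all_map; apply/andP; split.
    apply: sub_all smallD => e /and5P[h1 h2 h3 h4 h5].
    rewrite /small_entry /= h1 h2 /=; apply/and3P; split.
    - by case: ifP => // _; apply/ltnW/ltn_ord.
    - by case: ifP => // _; apply/ltnW/ltn_ord.
    - by rewrite -addn1 leq_add // leq_b1.
  by case: ifP => //= _; rewrite /small_entry /= !(ltnW (ltn_ord _)) !leqnn.
have size_D' : size (entries (next_state st p b c)) <= t.+1.
  by rewrite /= size_cat size_map -addn1 leq_add //; case: ifP.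
apply/and4P; split => //; first exact/ltnW/ltn_ord.
have hs : size (entries (next_state st p b c)) * t.+1 +
          n * size (entries (next_state st p b c)) <= B.
  by apply: leq_trans leB; rewrite leq_add ?leq_mul.
have g1 := leq_trans (gain1_le p.1 smallD') hs.
have g2 : gain2 (entries (next_state st p b c)) p.1 <= B.
  exact: leq_trans (sum_common_le _ smallD') (leq_trans (leq_addr _ _) hs).
have b1 : (if current st == p.1 then base1 st else acc1 st) <= t * B by case: ifP.
have b2 : (if current st == p.1 then base2 st else acc2 st) <= t * B by case: ifP.
rewrite /= !mulSn -/(entries _) [B + _]addnC !leq_add //=.
by rewrite (leq_trans b1) ?leq_addr // (leq_trans b2) ?leq_addr.
Qed.

Lemma small_run l M : size l <= M ->
  small_state (size l) (M * M + n * M) (run start l).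
Proof.
elim/last_ind: l => [|l p IH]; first by rewrite /small_state /= leqnn.
rewrite size_rcons => ltlM; rewrite /run foldl_rcons; apply: small_next_state.
  by rewrite leq_add ?leq_mul.
exact/IH/ltnW.
Qed.

Lemma words_small t B W st : small_state t B st -> 1 < W -> n < W -> t < W ->
  t * B < W -> all (fun x => x < W) (encode st).
Proof.
move=> /and4P[smallD _ cur_n /= /and5P[lb1 la1 lb2 la2 _]] W1 nW tW BW.
rewrite (leq_ltn_trans cur_n nW) (leq_ltn_trans lb1 BW) (leq_ltn_trans la1 BW).
rewrite (leq_ltn_trans lb2 BW) (leq_ltn_trans la2 BW) /=.
apply/allP => x /flattenP[_ /mapP[e /(allP smallD)/and5P[h1 h2 h3 h4 h5] ->]].
have bW (b : bool) : b < W by apply: leq_ltn_trans W1; case: b.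
by rewrite !inE => /or4P[|||/or4P[|||/or4P[|||]]] /eqP->; rewrite ?bW //;
  apply: leq_ltn_trans; eassumption.
Qed.

(** * Exact contents of the memory along the stream *)

Section Stream.
Variables (G : sgraph n) (s : adj_stream G).
Hypothesis O_sym : forall x y, adj G x y -> O x y = O y x.

Lemma mem_adj_list v u : (u \in adj_list s v) = adj G v u.
Proof. by rewrite (perm_mem (adj_listP s v)) mem_enum. Qed.

Lemma uniq_adj_list v : uniq (adj_list s v).
Proof. by rewrite (perm_uniq (adj_listP s v)) enum_uniq. Qed.

Lemma mem_list_order v : v \in list_order s.
Proof. by rewrite (perm_mem (list_orderP s)) mem_enum. Qed.

Lemma uniq_list_order : uniq (list_order s).
Proof. by rewrite (perm_uniq (list_orderP s)) enum_uniq. Qed.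

Definition items_of (vs : seq 'I_n) : seq ('I_n * 'I_n) :=
  [seq (v, y) | v <- vs, y <- adj_list s v].

Lemma items_of_rcons vs v :
  items_of (rcons vs v) = items_of vs ++ [seq (v, u) | u <- adj_list s v].
Proof. by rewrite /items_of -cats1 map_cat flatten_cat /= cats0. Qed.

Lemma mem_items_of vs p : (p \in items_of vs) = (p.1 \in vs) && adj G p.1 p.2.
Proof.
apply/allpairsPdep/andP => [[x [y [xvs yx ->]]]|[pvs pp]].
  by rewrite -mem_adj_list.
by exists p.1, p.2; rewrite mem_adj_list -surjective_pairing.
Qed.

Lemma uniq_items_of vs : uniq vs -> uniq (items_of vs).
Proof.
move=> uvs; apply: allpairs_uniq_dep => // [x _|]; first exact: uniq_adj_list.
by move=> [x y] [x' y'] _ _ /= [-> ->].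
Qed.

Lemma sum_items_of (A : Type) (idx : A) (op : Monoid.com_law idx) vs
    (P : pred ('I_n * 'I_n)) F : uniq vs ->
  \big[op/idx]_(p <- items_of vs | P p) F p =
  \big[op/idx]_(p | [&& p.1 \in vs, adj G p.1 p.2 & P p]) F p.
Proof.
move=> /uniq_items_of u; rewrite big_mkcond big_uniq //= -big_mkcondr.
by apply: eq_bigl => p; rewrite mem_items_of andbA.
Qed.

(** The initial value is immaterial: the list of [p.1] resets the entry, and [entries_at] uses it
    only after that list has been read. *)
Definition entry_at (vs : seq 'I_n) (p : 'I_n * 'I_n) : entry :=
  foldl (fun e v => if v == p.1 then fresh_item p else scan v (adj_list s v) e)
    (fresh_item p) vs.

Definition entries_at (vs : seq 'I_n) : seq entry :=
  [seq entry_at vs p | p <- items_of vs & kept_item p].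

Lemma entry_at_rcons vs v p : entry_at (rcons vs v) p =
  if v == p.1 then fresh_item p else scan v (adj_list s v) (entry_at vs p).
Proof. by rewrite /entry_at foldl_rcons. Qed.

Lemma entry_at_const vs p : let e := entry_at vs p in
  [/\ src e = p.1, dst e = p.2, heavy e = O p.1 p.2,
      coin_m e = (coins p).1 & coin_a e = (coins p).2].
Proof.
elim/last_ind: vs => [|vs v IH]; first by [].
rewrite /= entry_at_rcons; case: ifP => // _.
by elim/last_ind: (adj_list s v) => [|us u IHu]; rewrite /scan ?foldl_rcons.
Qed.

Lemma collect_entries_at vs v : v \notin vs ->
  collect (entries_at vs) v (adj_list s v) = entries_at (rcons vs v).
Proof.
move=> vvs; rewrite collectE ?uniq_adj_list ?mem_adj_list ?adj_irr //.
rewrite /entries_at items_of_rcons filter_cat map_cat -map_comp.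
congr (_ ++ _); apply/eq_in_map => p; rewrite mem_filter => /andP[_].
  rewrite mem_items_of => /andP[pvs _] /=; rewrite entry_at_rcons.
  by case: eqP vvs => // ->; rewrite pvs.
by case/mapP => u _ ->; rewrite entry_at_rcons eqxx.
Qed.

Lemma prefix_before vs v vs' : list_order s = rcons vs v ++ vs' ->
  forall w, (w \in vs) = before s w v.
Proof.
move=> lo w; have := uniq_list_order; rewrite /before lo cat_rcons.
rewrite cat_uniq => /and3P[uvs /norP[vvs _] _].
rewrite [index v _]index_cat (negPf vvs) /= eqxx addn0 index_cat.
by case: ifP => [wvs|_]; rewrite ?index_mem // ltnNge leq_addr.
Qed.

Lemma before_irr v : before s v v = false.
Proof. by rewrite /before ltnn. Qed.

Lemma before_trans : transitive (before s).
Proof. by move=> y x z; apply: ltn_trans. Qed.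

Lemma before_total x y : x != y -> before s x y || before s y x.
Proof.
move=> xy; rewrite /before -neq_ltn; apply: contra xy => /eqP e.
by rewrite -(nth_index x (mem_list_order x)) e nth_index ?mem_list_order.
Qed.

(** Induction on the lists read. The stamps need not be known exactly: that they differ from every
    unread vertex is what [scan_entry] requires at the next list. *)
Lemma entry_atE vs vs' a z : list_order s = vs ++ vs' -> a \in vs -> adj G a z ->
  exists l1 l2 h, entry_at vs (a, z) =
    Entry a z l1 l2 h ((z \in vs) && before s a z)
      (count (fun w => [&& before s a w, adj G w a & adj G w z]) vs)
      (O a z) (coins (a, z)).1 (coins (a, z)).2
  /\ forall v : 'I_n, v \notin vs -> (l1 != v) && (l2 != v).
Proof.
move=> + + az; elim/last_ind: vs vs' => // vs v IH vs' lo.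
have bef := prefix_before lo.
have a_z : a != z by apply: contraTneq az => ->; rewrite adj_irr.
have nb w : before s v w -> w \notin rcons vs v.
  rewrite mem_rcons inE bef negb_or => vw; apply/andP; split.
    by apply: contraTneq vw => ->; rewrite before_irr.
  by apply/negP => /(before_trans vw); rewrite before_irr.
rewrite mem_rcons inE entry_at_rcons /= eq_sym.
have [av _|va /= avs] := eqVneq v a.
  subst v; exists n, n, false; split.
    congr Entry.
      by apply/esym/negP => /andP[+ /nb/negP].
    apply/esym/eqP; rewrite eqn0Ngt -has_count; apply/hasPn => w.
    by apply: contraL => /and3P[/nb].
  by move=> v _; rewrite !gtn_eqF.
have [|l1 [l2 [h [-> l12]]]] := IH (v :: vs') _ avs; first by rewrite -cat_rcons.
have vvs : v \notin vs by rewrite bef before_irr.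
have /andP[l1v l2v] := l12 v vvs.
rewrite scan_entry ?uniq_adj_list ?(negPf l1v) ?(negPf l2v) //.
rewrite !mem_adj_list andbF !orbF; do 3 eexists; split.
  congr Entry.
    rewrite mem_rcons inE andb_orl orbC; congr (_ || _).
    have [zv|//] := eqVneq z v.
    by rewrite zv -bef avs -zv adj_sym az.
  by rewrite -cats1 count_cat /= addn0 -bef avs.
move=> w; rewrite mem_rcons inE negb_or => /andP[wv /l12/andP[w1 w2]].
have vw : (v : nat) != w by rewrite val_eqE eq_sym.
by case: ifP => _; case: ifP => _; rewrite ?vw ?w1 ?w2.
Qed.

(** Both stamps equal [v] exactly when [v] is adjacent to both endpoints. The oracle was asked about
    [(v, a)], hence the appeal to [O_sym]. *)
Lemma entry_at_hit vs v vs' a z : list_order s = rcons vs v ++ vs' ->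
  a \in vs -> adj G a z ->
  let e := entry_at (rcons vs v) (a, z) in
  [&& dst_seen e, last_src e == v, last_dst e == v & src_heavy e] =
  [&& adj G a v, adj G z v, O a v, before s a z & before s z v].
Proof.
move=> lo avs az; have bef := prefix_before lo.
have vvs : v \notin vs by rewrite bef before_irr.
have a_z : a != z by apply: contraTneq az => ->; rewrite adj_irr.
have [|l1 [l2 [h [eE l12]]]] := @entry_atE vs (v :: vs') a z _ avs az.
  by rewrite -cat_rcons.
have /andP[l1v l2v] := l12 v vvs.
rewrite entry_at_rcons /=; have [va|_] := eqVneq v a.
  by move: vvs; rewrite va avs.
rewrite eE scan_entry ?uniq_adj_list ?(negPf l1v) ?(negPf l2v) //=.
rewrite !mem_adj_list -bef !(adj_sym _ v).
case va: (adj G a v); last by rewrite /= (negPf l1v) /= andbF.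
case vz: (adj G z v); last by rewrite /= (negPf l2v) /= !andbF.
rewrite !eqxx /= (O_sym va); have [zv|_] := eqVneq z v.
  by move: vz; rewrite zv adj_irr.
by rewrite orbF; case: (O v a); case: (z \in vs); case: (before s a z).
Qed.

Definition between (a v : 'I_n) : {set 'I_n} :=
  [set z | [&& [set a; v; z] \in triangles G, before s a z & before s z v]].

Lemma triangleE a v z : a != v -> a != z -> v != z ->
  ([set a; v; z] \in triangles G) = [&& adj G a v, adj G a z & adj G v z].
Proof.
move=> av az vz; rewrite inE; have -> /= : #|[set a; v; z]| == 3.
  by rewrite -setUA cardsU1 !inE negb_or av az cards2 vz.
apply/forall_inP/and3P => [tri|[Aav Aaz Avz] x xin].
  have adjE x y : x \in [set a; v; z] -> y \in [set a; v; z] -> x != y -> adj G x y.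
    by move=> /tri/forall_inP/(_ y) h /h; move/implyP.
  by split; apply: adjE => //; rewrite !inE eqxx ?orbT.
apply/forall_inP => y yin; apply/implyP; move: xin yin; rewrite !inE -!orbA.
by do 2 case/or3P => /eqP->; rewrite ?eqxx // adj_sym.
Qed.

Lemma in_between a v z : (z \in between a v) =
  [&& adj G a v, adj G a z, adj G v z, before s a z & before s z v].
Proof.
rewrite inE; case az: (before s a z); last by rewrite !andbF.
case zv: (before s z v); last by rewrite !andbF.
have av := before_trans az zv; have neq x y : before s x y -> x != y.
  by apply: contraTneq => ->; rewrite before_irr.
by rewrite triangleE ?andbT ?(neq _ _ av) ?(neq _ _ az) // eq_sym neq.
Qed.

Definition pair_hits (a v : 'I_n) : nat :=
  #|[set z in between a v | (coins (a, z)).2]|.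

Lemma aux_hitsE vs v vs' (a : 'I_n) : list_order s = rcons vs v ++ vs' ->
  aux_hits (entries_at (rcons vs v)) a v = if O a v then pair_hits a v else 0.
Proof.
move=> lo; have bef := prefix_before lo.
have uvs : uniq (rcons vs v).
  by move: uniq_list_order; rewrite lo cat_uniq => /andP[].
rewrite /aux_hits -sum1_count big_map big_filter_cond sum_items_of //.
rewrite (eq_bigl (fun p => [&& p.1 == a, p.2 \in between a v, (coins p).2 & O a v])).
  rewrite /pair_hits; case: (O a v); last first.
    by rewrite big_pred0 // => p; rewrite !andbF.
  rewrite -sum1_card (reindex_onto (pair a) snd) => [|[x y] /=]; last first.
    by case/andP => /eqP->.
  by apply: eq_bigl => z; rewrite /= !eqxx !inE !andbT.
move=> [x z] /=; rewrite mem_rcons inE.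
have [-> _ _ _ ->] := entry_at_const (rcons vs v) (x, z); rewrite val_eqE /=.
have [xa|_] := eqVneq x a; last by rewrite !andbF.
subst x; have bw : z \in between a v -> a \in vs.
  by rewrite in_between bef => /and5P[_ _ _]; apply: before_trans.
have [av|av] := eqVneq a v.
  rewrite -[in entry_at _ _]av entry_at_rcons eqxx /= !andbF.
  by case: (z \in _) bw => // /(_ isT); rewrite av bef before_irr.
case avs: (a \in vs) bw; last by case: (z \in _) => // /(_ isT).
move=> _ /=.
rewrite in_between; case az: (adj G a z); last by rewrite /= andbF.
rewrite (entry_at_hit lo avs az) (adj_sym G v z) /kept_item /kept.
case: (coins (a, z)).2; rewrite /= ?andbF //.
by rewrite -!andbA; do !bool_congr; case: (O a v); rewrite ?andbF ?andbT.
Qed.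

(** When the list of [v] is read, an entry [a -> v] has counted the common neighbours after [a] and
    up to [v]; since [v] is not its own neighbour, they are those strictly between. *)
Lemma sum_ending_at vs v vs' (Q : pred entry) : list_order s = rcons vs v ++ vs' ->
  \sum_(e <- entries_at (rcons vs v) | (dst e == v) && Q e) common e =
  \sum_(a | [&& adj G a v, before s a v, kept_item (a, v)
            & Q (entry_at (rcons vs v) (a, v))]) tri_between s a v.
Proof.
move=> lo; have bef := prefix_before lo.
have uvs : uniq (rcons vs v).
  by move: uniq_list_order; rewrite lo cat_uniq => /andP[].
rewrite big_map big_filter_cond sum_items_of //.
rewrite (reindex_onto (pair^~ v) fst) => [|[x y] /=]; last first.
  have [_ dE _ _ _] := entry_at_const (rcons vs v) (x, y).
  by rewrite dE val_eqE /= => /and5P[_ _ _ /eqP->].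
have eqP' a : [&& a \in rcons vs v, adj G a v & kept_item (a, v) &&
      ((dst (entry_at (rcons vs v) (a, v)) == v) &&
        Q (entry_at (rcons vs v) (a, v)))] && (a == a) =
   [&& adj G a v, before s a v, kept_item (a, v)
            & Q (entry_at (rcons vs v) (a, v))].
  have [_ dE _ _ _] := entry_at_const (rcons vs v) (a, v).
  rewrite dE !eqxx andbT /= mem_rcons inE -bef; have [->|_] := eqVneq a v.
    by rewrite adj_irr.
  by rewrite /= andbCA.
rewrite (eq_bigl _ _ eqP'); apply: eq_bigr => a /and4P[av bav _ _].
have [|l1 [l2 [h [-> _]]]] := @entry_atE (rcons vs v) vs' a v lo _ av.
  by rewrite mem_rcons inE bef bav orbT.
rewrite /= /tri_between -sum1_count -sum1_card.
rewrite big_mkcond big_uniq //= -big_mkcondr.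
apply: eq_bigl => z; rewrite -/(between a v) in_between mem_rcons inE bef.
rewrite av (adj_sym G z a) (adj_sym G z v); have [->|_] := eqVneq z v.
  by rewrite adj_irr before_irr !andbF.
by case: (before s z v); case: (before s a z); rewrite /= ?andbF ?andbT.
Qed.

(** Intended gains at the list of [v], stated from the graph and the coins without reference to the
    memory. *)
Definition spec1 (v : 'I_n) : nat :=
  \sum_(a | adj G a v && before s a v)
    (if O a v then if_big (pair_hits a v)
     else (coins (a, v)).2 * tri_between s a v).

Definition spec2 (v : 'I_n) : nat :=
  \sum_(a | adj G a v && before s a v)
    (O a v && ~~ big (pair_hits a v) && (coins (a, v)).1) * tri_between s a v.

Lemma if_big0 : if_big 0 = 0.
Proof. by rewrite /if_big; case: ifP. Qed.

Lemma pair_hits0 a v : ~~ (adj G a v && before s a v) -> pair_hits a v = 0.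
Proof.
move=> nav; apply/eqP; rewrite cards_eq0 -subset0; apply/subsetP => z.
rewrite inE in_between => /andP[/and5P[av _ _ az zv] _].
by move: nav; rewrite av (before_trans az zv).
Qed.

Lemma gain1E vs v vs' : list_order s = rcons vs v ++ vs' ->
  gain1 (entries_at (rcons vs v)) v = spec1 v.
Proof.
move=> lo; rewrite /gain1.
rewrite (sum_ending_at (fun e => ~~ heavy e && coin_a e) lo).
under [X in _ + X]eq_bigr => a _ do rewrite (aux_hitsE a lo).
(* The hits are summed over all vertices [a], but a pair that is not an edge with [a] first has no
   hit and contributes [if_big 0 = 0]. *)
rewrite (bigID (fun a => adj G a v && before s a v) xpredT) /=.
rewrite [X in _ + (_ + X)]big1 ?addn0 => [|a nav]; last first.
  by rewrite pair_hits0 // if_same if_big0.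
under eq_bigl => a do rewrite andbA.
rewrite big_mkcondr -big_split; apply: eq_bigr => a _ /=.
have [_ _ -> _ ->] := entry_at_const (rcons vs v) (a, v).
rewrite /kept_item /kept /=; case: (O a v); case: (coins (a, v)).2;
  by rewrite /= ?andbF ?if_big0 ?mul1n ?addn0.
Qed.

Lemma gain2E vs v vs' : list_order s = rcons vs v ++ vs' ->
  gain2 (entries_at (rcons vs v)) v = spec2 v.
Proof.
move=> lo; rewrite /gain2.
rewrite (sum_ending_at (fun e => [&& heavy e, coin_m e
  & ~~ big (aux_hits (entries_at (rcons vs v)) (src e) v)]) lo).
under eq_bigl => a do rewrite andbA.
rewrite big_mkcondr; apply: eq_bigr => a _ /=.
have [-> _ -> -> _] := entry_at_const (rcons vs v) (a, v).
rewrite (aux_hitsE a lo) /kept_item /kept /=.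
case: (O a v); case: (coins (a, v)).1; rewrite ?andbF ?andbT ?orbT //=.
by case: (~~ _); rewrite ?mul1n ?mul0n.
Qed.

Lemma run_prefix vs vs' : list_order s = vs ++ vs' ->
  let st := run start (items_of vs) in
  [/\ entries st = entries_at vs, forall v : 'I_n, v \notin vs -> current st != v,
      acc1 st = \sum_(v <- vs) spec1 v & acc2 st = \sum_(v <- vs) spec2 v].
Proof.
elim/last_ind: vs vs' => [|vs v IH] vs' lo.
  by split; rewrite ?big_nil // => v _; rewrite /= gtn_eqF.
have vvs : v \notin vs by rewrite (prefix_before lo) before_irr.
case: (IH (v :: vs')); first by rewrite -cat_rcons.
rewrite items_of_rcons /run foldl_cat -/(run start (items_of vs)).
rewrite -[foldl _ _ _]/(run _ _); move: (run start _) => st eD ecur e1 e2.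
rewrite -!cats1 !big_cat !big_seq1 /= cats1 -(gain1E lo) -(gain2E lo) -e1 -e2.
rewrite -(collect_entries_at vvs) -eD.
(* An isolated vertex produces no item, so the algorithm does not notice its list; the intended
   gains are then empty sums. *)
have [nil_v|nnil] := eqVneq (adj_list s v) [::]; last first.
  rewrite run_block ?ecur //; split=> // w.
  by rewrite mem_rcons inE negb_or val_eqE eq_sym => /andP[].
have noadj a : adj G a v && before s a v = false.
  by rewrite adj_sym -mem_adj_list nil_v.
rewrite eD collect_entries_at // (gain1E lo) (gain2E lo) /spec1 /spec2.
rewrite !(big_pred0 _ _ _ _ noadj) !addn0 -(collect_entries_at vvs) nil_v.
by split=> // w; rewrite mem_rcons inE negb_or => /andP[_ /ecur].
Qed.

Lemma run_items : let st := run start (items s) in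
  acc1 st = \sum_v spec1 v /\ acc2 st = \sum_v spec2 v.
Proof.
rewrite /= -[items s]/(items_of (list_order s)).
have [|_ _ -> ->] := @run_prefix (list_order s) [::]; first by rewrite cats0.
by split; rewrite big_uniq ?uniq_list_order //=; apply: eq_bigl => v;
  rewrite mem_list_order.
Qed.

End Stream.
End Run.
End Algorithm.

(** * Counting triangles by oriented edges *)

Section Counting.
Variables (n : nat) (G : sgraph n) (s : adj_stream G).

Definition oriented (p : 'I_n * 'I_n) : bool := adj G p.1 p.2 && before s p.1 p.2.

Lemma before_neg x y : x != y -> ~~ before s x y = before s y x.
Proof.
move=> /(before_total s); rewrite /before; lia.
Qed.

Lemma adj_neq x y : adj G x y -> x != y.
Proof. by apply: contraTneq => ->; rewrite adj_irr. Qed.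

Lemma sum_adj_oriented (F : 'I_n * 'I_n -> nat) :
  \sum_(p | adj G p.1 p.2) F p =
  \sum_(p | oriented p) F p + \sum_(p | oriented p) F (p.2, p.1).
Proof.
rewrite (bigID (fun p => before s p.1 p.2)) /=; congr (_ + _).
pose swap (p : 'I_n * 'I_n) := (p.2, p.1).
rewrite (reindex_onto swap swap) => [|[x y] //].
apply: eq_bigl => -[x y]; rewrite /oriented /= eqxx andbT adj_sym.
by case xy: (adj G x y) => //=; rewrite before_neg // eq_sym adj_neq.
Qed.

Lemma card_oriented_le : #|[set p | oriented p]| <= #|edges G|.
Proof.
rewrite -(card_in_imset (f := fun p => [set p.1; p.2])); last first.
  move=> [x y] [x' y']; rewrite !inE /oriented /= => /andP[_ xy] /andP[_ xy'] e.
  have xin : x \in [set x'; y'] by rewrite -e !inE eqxx.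
  have yin : y \in [set x'; y'] by rewrite -e !inE eqxx orbT.
  move: xin yin xy xy'; rewrite !inE /before.
  by do 2 (case/orP => /eqP->); try lia.
apply/subset_leq_card/subsetP => A /imsetP[p]; rewrite inE => /andP[adj_p _] ->.
by apply/imsetP; exists p; rewrite ?inE.
Qed.

Lemma card_adj_le : #|[set p : 'I_n * 'I_n | adj G p.1 p.2]| <= 2 * #|edges G|.
Proof.
rewrite -sum1_card (eq_bigl (fun p : 'I_n * 'I_n => adj G p.1 p.2)) => [|p].
  rewrite (sum_adj_oriented (fun=> 1)) mul2n -addnn leq_add //.
    by rewrite sum1dep_card card_oriented_le.
  by rewrite sum1dep_card card_oriented_le.
by rewrite inE.
Qed.

(** Sorting the vertices of a triangle in stream order makes triangles correspond bijectively to
    triples [(a, v, z)] with [z] between [a] and [v]. *)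
Lemma sum_tri_between :
  \sum_(p | oriented p) tri_between s p.1 p.2 = #|triangles G|.
Proof.
pose X := [set q : 'I_n * 'I_n * 'I_n | q.2 \in between s q.1.1 q.1.2].
have -> : \sum_(p | oriented p) tri_between s p.1 p.2 = #|X|.
  rewrite -sum1_card (eq_bigl (fun q : 'I_n * 'I_n * 'I_n =>
    oriented q.1 && (q.2 \in between s q.1.1 q.1.2))) => [|[[a v] z]].
    rewrite -(pair_big_dep oriented (fun p z => z \in between s p.1 p.2)
      (fun _ _ => 1)).
    by apply: eq_bigr => p _; rewrite sum1_card.
  rewrite inE /= in_between /oriented /=.
  case: (adj G a v) => //=; case az: (before s a z); rewrite ?andbF //.
  by case zv: (before s z v); rewrite ?andbF // (before_trans az zv).
pose f (q : 'I_n * 'I_n * 'I_n) := [set q.1.1; q.1.2; q.2].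
have <- : f @: X = triangles G.
  apply/setP => A; apply/imsetP/idP => [[[[a v] z]]|triA].
    by rewrite 2!inE /= => /and3P[+ _ _] ->.
  have [x [y [z [xy xz yz eA]]]] : exists x y z,
      [/\ x != y, x != z, y != z & A = [set x; y; z]].
    have card_A : #|A| = 3 by move: triA; rewrite inE => /andP[/eqP].
    have /card_gt0P[x xA] : 0 < #|A| by rewrite card_A.
    have /cards2P[y [z [yz e]]] : #|A :\ x| == 2.
      by move: card_A; rewrite (cardsD1 x) xA add1n => -[->].
    exists x, y, z; have := setD1K xA; rewrite e setUA => <-.
    have yA : y \in A :\ x by rewrite e !inE eqxx.
    have zA : z \in A :\ x by rewrite e !inE eqxx orbT.
    move: yA zA; rewrite !inE => /andP[yx _] /andP[zx _].
    by split; rewrite // eq_sym.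
  have go a z' v : before s a z' -> before s z' v ->
      [set x; y; z] =i [set a; v; z'] ->
      exists2 q, q \in X & A = f q.
    move=> az zv /setP; rewrite -eA => e; exists (a, v, z') => //.
    by rewrite !inE /= az zv !andbT; move: triA; rewrite e inE.
  have cyc a b c : before s a b -> before s b c -> before s c a -> False.
    by rewrite /before; lia.
  have [/orP h1 /orP h2] := (before_total s xy, before_total s xz).
  have /orP h3 := before_total s yz.
  have boolP3 w (a v z' : 'I_n) : (w \in [set a; v; z']) =
      [|| w == a, w == v | w == z'] by rewrite !inE -orbA.
  (* Of the eight outcomes of the three comparisons, two are cyclic and impossible; the other six
     are the orderings of [x], [y], [z]. *)
  case: h1 h2 h3 => h1 [] h2 [] h3; do ?[by case: (cyc _ _ _ h1 h3 h2) | by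
    case: (cyc _ _ _ h1 h2 h3)].
  - by apply: (go x y z) => // w; rewrite !boolP3;
    case: (w == x); case: (w == y); case: (w == z).
  - by apply: (go x z y) => // w; rewrite !boolP3;
    case: (w == x); case: (w == y); case: (w == z).
  - by apply: (go z x y) => // w; rewrite !boolP3;
    case: (w == x); case: (w == y); case: (w == z).
  - by apply: (go y x z) => // w; rewrite !boolP3;
    case: (w == x); case: (w == y); case: (w == z).
  - by apply: (go y z x) => // w; rewrite !boolP3;
    case: (w == x); case: (w == y); case: (w == z).
  - by apply: (go z y x) => // w; rewrite !boolP3;
    case: (w == x); case: (w == y); case: (w == z).
rewrite card_in_imset // => -[[a v] z] [[a' v'] z'].
rewrite !inE /= => /and3P[_ az zv] /and3P[_ az' zv'] e.
have ain : a \in f (a', v', z') by rewrite -e !inE eqxx.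
have vin : v \in f (a', v', z') by rewrite -e !inE eqxx orbT.
have zin : z \in f (a', v', z') by rewrite -e !inE eqxx !orbT.
move: ain vin zin az zv az' zv'; rewrite !inE /before /= -!orbA.
by do 3 (case/or3P => /eqP->); try lia.
Qed.

End Counting.

Local Open Scope ring_scope.

(** * Memory budget and estimator *)

Section Guarded.
Variables (R : realType) (n W : nat) (cap tau tau2 p2 p3 : R).
Hypotheses (p2_ge0 : 0 <= p2 <= 1) (p3_ge0 : 0 <= p3 <= 1).

Definition fits (mem : seq nat) : bool :=
  all (fun x => (x < W)%N) mem && ((size mem)%:R <= cap).

(* Exceeding the budget erases the memory for good. *)
Definition guard (mem : seq nat) : seq nat := if fits mem then mem else [::].

(** The empty sequence can mark failure because an encoded state has at least five words. *)
Definition guarded_step (mem : seq nat) (p : 'I_n * 'I_n) (b : bool)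
    (c : bool * bool) : seq nat :=
  if mem is [::] then [::]
  else guard (encode (next_state (big_hits p3 tau2) (decode mem) p b c)).

Definition coin_weight (c : bool * bool) : R := bern p2 c.1 * bern p3 c.2.

Lemma coin_weight_ge0 c : 0 <= coin_weight c.
Proof.
have /andP[p20 p21] := p2_ge0; have /andP[p30 p31] := p3_ge0.
by rewrite mulr_ge0 // /bern; case: ifP; rewrite ?subr_ge0.
Qed.

Lemma coin_weight_sum1 : \sum_c coin_weight c = 1.
Proof.
rewrite -(pair_bigA _ (fun x y => coin_weight (x, y))) /= !big_bool /=.
by rewrite /coin_weight /bern /=; ring.
Qed.

Definition guarded_alg : oracle_streaming_alg R n :=
  @OracleStreamingAlg R n tau (bool * bool)%type coin_weight coin_weight_ge0
    coin_weight_sum1 (guard (encode (start n))) guarded_step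
    (fun mem => (acc1 (decode mem))%:R / p3 + (acc2 (decode mem))%:R / p2).

Lemma guarded_space (O : rel 'I_n) l : 0 <= cap ->
  runs_in_space guarded_alg O l W cap.
Proof.
move=> cap0 w st st_in; suff : fits st by case/andP.
have fits0 : fits [::] by rewrite /fits.
have fits_guard mem : fits (guard mem) by rewrite /guard; case: ifP.
move: st_in; rewrite /memories in_cons => /orP[/eqP->|]; first exact: fits_guard.
elim: (zip l w) (init guarded_alg) => //= x xs IH mem.
rewrite in_cons => /orP[/eqP->|/IH//].
by rewrite /item_step /= /guarded_step; case: mem.
Qed.

Section GoodRun.
Variables (O : rel 'I_n) (l : seq ('I_n * 'I_n)).
Variable w : (size l).-tuple (bool * bool).

(** Coins are drawn by position while the analysis of the run indexes them by item; the two agree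
    when the items are distinct. *)
Definition coin_of (p : 'I_n * 'I_n) : bool * bool :=
  nth (false, false) w (index p l).

Let st k := run (big_hits p3 tau2) O coin_of (start n) (take k l).

Lemma guarded_run : (forall k, fits (encode (st k))) ->
  foldl (fun mem p => guarded_step mem p (O p.1 p.2) (coin_of p))
    (guard (encode (start n))) l = encode (st (size l)).
Proof.
move=> fit; have guardE k : guard (encode (st k)) = encode (st k).
  by rewrite /guard fit.
suff H k : (k <= size l)%N ->
    foldl (fun mem p => guarded_step mem p (O p.1 p.2) (coin_of p))
    (guard (encode (start n))) (take k l) = encode (st k).
  by rewrite -[in LHS](take_size l) H.
elim: k => [|k IH] ltk; first by rewrite -guardE /st !take0.
have [p0 _] : exists p0, p0 \in l.
  by case: (l) ltk => // p0 l' _; exists p0; rewrite mem_head.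
rewrite (take_nth p0) // foldl_rcons IH ?(ltnW ltk) // -[RHS]guardE.
rewrite /st (take_nth p0) // /run foldl_rcons.
by rewrite /guarded_step encodeK.
Qed.

Lemma guarded_result : uniq l -> (forall k, fits (encode (st k))) ->
  @result R n guarded_alg O l w =
  (acc1 (st (size l)))%:R / p3 + (acc2 (st (size l)))%:R / p2.
Proof.
move=> uniq_l fit; rewrite /result /=.
have wE : tval w = [seq coin_of p | p <- l].
  apply: (@eq_from_nth _ (false, false)); rewrite ?size_map size_tuple // => i lti.
  have [p0 _] : exists p0, p0 \in l.
    by case: (l) lti => // p0 l' _; exists p0; rewrite mem_head.
  by rewrite (nth_map p0) // /coin_of index_uniq.
have zE : zip l w = [seq (p, coin_of p) | p <- l].
  by rewrite wE -[X in zip X _]map_id zip_map.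
rewrite zE; have -> : forall mem, foldl (item_step (A := guarded_alg) O) mem
     [seq (p, coin_of p) | p <- l] =
   foldl (fun mem p => guarded_step mem p (O p.1 p.2) (coin_of p)) mem l.
  by elim: (l) => //= p l' IH mem; rewrite IH.
by rewrite guarded_run // encodeK.
Qed.

End GoodRun.
End Guarded.

(** * The output as an estimate over stream positions *)

Section StreamEstimate.
Variables (R : realType) (n : nat) (G : sgraph n) (s : adj_stream G).
Variables (p2 p3 tau2 : R) (O : rel 'I_n).
Variable w : (size (items s)).-tuple (bool * bool).

Let I := 'I_(size (items s)).

Definition item (i : I) : 'I_n * 'I_n := tnth (in_tuple (items s)) i.

Definition xcoins : {ffun I -> bool} := [ffun i => (tnth w i).1].
Definition ycoins : {ffun I -> bool} := [ffun i => (tnth w i).2].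

Definition light_item (i : I) : bool :=
  before s (item i).1 (item i).2 && ~~ O (item i).1 (item i).2.
Definition heavy_item (i : I) : bool :=
  before s (item i).1 (item i).2 && O (item i).1 (item i).2.
Definition item_R (i : I) : nat := tri_between s (item i).1 (item i).2.
Definition item_fan (i : I) : {set I} :=
  [set j | ((item j).1 == (item i).1)
             && ((item j).2 \in between s (item i).1 (item i).2)].

Lemma uniq_items : uniq (items s).
Proof. exact: uniq_items_of (uniq_list_order s). Qed.

Lemma coin_item i : coin_of w (item i) = tnth w i.
Proof.
rewrite /coin_of /item (tnth_nth (item i)) index_uniq ?uniq_items //.
by rewrite (tnth_nth (false, false)).
Qed.

Lemma sum_item (A : Type) (idx : A) (op : Monoid.com_law idx)
    (P : pred ('I_n * 'I_n)) (F : 'I_n * 'I_n -> A) :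
  \big[op/idx]_(i : I | P (item i)) F (item i) =
  \big[op/idx]_(p | adj G p.1 p.2 && P p) F p.
Proof.
rewrite -[LHS](big_tnth _ _ (items s)) (sum_items_of _ _ _ _ (uniq_list_order s)).
by apply: eq_bigl => p; rewrite mem_list_order.
Qed.

(** Each [z] between [a] and [v] is a neighbour of [a], so [(a, z)] occurs at exactly one position:
    hits, which count positions, agree with [pair_hits], which counts vertices. *)
Lemma card_fan (Q : pred ('I_n * 'I_n)) (a v : 'I_n) :
  #|[set j | [&& (item j).1 == a, (item j).2 \in between s a v & Q (item j)]]| =
  #|[set z in between s a v | Q (a, z)]|.
Proof.
rewrite -!sum1dep_card.
rewrite (sum_item _ (fun p => [&& p.1 == a, p.2 \in between s a v & Q p])
  (fun=> 1%N)).
rewrite (reindex_onto (pair a) snd) => [|[x y] /=]; last first.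
  by case/and3P => _ /eqP->.
apply: eq_bigl => z /=; rewrite !eqxx andbT /=.
by case: (boolP (z \in _)); rewrite ?andbF // in_between => /and5P[_ -> _ _ _].
Qed.

Lemma card_item_fan i : #|item_fan i| = item_R i.
Proof.
rewrite /item_R /tri_between -/(between s _ _).
have := card_fan xpredT (item i).1 (item i).2.
have -> : [set z in between s (item i).1 (item i).2 | xpredT ((item i).1, z)] =
  between s (item i).1 (item i).2 by apply/setP => z; rewrite !inE andbT.
by move=> <-; apply: eq_card => j; rewrite !inE andbT.
Qed.

Lemma hits_item i : hits item_fan ycoins i =
  pair_hits (coin_of w) s (item i).1 (item i).2.
Proof.
rewrite /pair_hits -(card_fan (fun p => (coin_of w p).2)).
apply: eq_card => j; rewrite [LHS]inE [j \in item_fan i]inE [RHS]inE ffunE.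
by rewrite coin_item -andbA.
Qed.

Lemma estimate_items :
  (\sum_v spec1 (big_hits p3 tau2) O (coin_of w) s v)%:R / p3 +
  (\sum_v spec2 (big_hits p3 tau2) O (coin_of w) s v)%:R / p2 =
  estimate p2 p3 tau2 light_item heavy_item item_R item_fan xcoins ycoins.
Proof.
have pairE (F : 'I_n -> 'I_n -> nat) :
    (\sum_v \sum_(a | adj G a v && before s a v) F a v)%:R =
    \sum_(i : I | before s (item i).1 (item i).2) (F (item i).1 (item i).2)%:R :> R.
  rewrite (exchange_big_dep xpredT) //= pair_big_dep /=.
  rewrite (sum_item _ (fun p => before s p.1 p.2) (fun p => (F p.1 p.2)%:R)).
  by rewrite natr_sum.
rewrite !pairE !mulr_suml -big_split /estimate /=.
rewrite [RHS]addrC (bigID (fun i => O (item i).1 (item i).2)) /=.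
congr (_ + _); apply: eq_bigr => i /andP[_]; last first.
  move=> /negPf hO; rewrite hO /= mul0n mul0r addr0 ffunE -surjective_pairing.
  by rewrite coin_item natrM [_%:R * _]mulrC.
move=> hO; rewrite hO hits_item /if_big -surjective_pairing coin_item ffunE.
case: ifP => _ /=; first by rewrite mul0n mul0r addr0.
by rewrite mul0r add0r natrM [_%:R * _]mulrC.
Qed.

End StreamEstimate.

(** Splitting a tuple of pairs into two functions is a bijection under which the weights multiply,
    so both coin families are independent. *)
Lemma sum_coin_tuples (R : realType) (N : nat) (p2 p3 : R)
    (F : {ffun 'I_N -> bool} -> {ffun 'I_N -> bool} -> R) :
  \sum_(w : N.-tuple (bool * bool)) (\prod_(r <- w) coin_weight p2 p3 r) *
     F [ffun i => (tnth w i).1] [ffun i => (tnth w i).2] =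
  bexp p3 (fun y => bexp p2 (fun x => F x y)).
Proof.
rewrite /bexp; under [RHS]eq_bigr => y _ do rewrite mulr_sumr.
rewrite [RHS]pair_bigA /=.
pose split (w : N.-tuple (bool * bool)) :
    {ffun 'I_N -> bool} * {ffun 'I_N -> bool} :=
  ([ffun i => (tnth w i).2], [ffun i => (tnth w i).1]).
pose join (q : {ffun 'I_N -> bool} * {ffun 'I_N -> bool}) : N.-tuple (bool * bool) :=
  [tuple (q.2 i, q.1 i) | i < N].
have splitK : cancel split join.
  move=> w; apply: eq_from_tnth => i; rewrite tnth_mktuple !ffunE.
  by rewrite -surjective_pairing.
have joinK : cancel join split.
  by move=> [y x]; congr (_, _); apply/ffunP => i; rewrite ffunE tnth_mktuple.
rewrite [RHS](reindex split) /=; last by apply: onW_bij; exists join.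
apply: eq_bigr => w _; rewrite mulrA; congr (_ * _).
rewrite big_tuple -big_split; apply: eq_bigr => i _.
by rewrite /coin_weight !ffunE mulrC.
Qed.

(** * Success probability *)

Section Success.
Variables (R : realType) (n : nat) (G : sgraph n) (s : adj_stream G).
Variables (tau tau2 p2 p3 eta X : R) (O : rel 'I_n).
Hypotheses (p2_gt0 : 0 < p2) (p2_le1 : p2 <= 1).
Hypotheses (p3_gt0 : 0 < p3) (p3_le1 : p3 <= 1).
Hypothesis oracleP : perfect_heavy_oracle s tau O.

Let l := items s.
Let T : R := #|triangles G|%:R.
Let N : R := (size l)%:R.
Let heavies : R := #|[set i | O (item (s := s) i).1 (item i).2]|%:R.

Lemma edge_R_sym x y : adj G x y -> edge_R s x y = edge_R s y x.
Proof.
move=> /adj_neq xy; rewrite /edge_R -(before_neg s xy).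
by case: (before s x y).
Qed.

Lemma oracle_sym x y : adj G x y -> O x y = O y x.
Proof.
by move=> xy; rewrite !oracleP ?(edge_R_sym xy) // adj_sym.
Qed.

Lemma adj_item i : adj G (item (s := s) i).1 (item i).2.
Proof.
have : item i \in items s by apply: mem_tnth.
by rewrite -[items s]/(items_of s (list_order s)) mem_items_of => /andP[].
Qed.

Lemma size_items_le : (size l <= 2 * #|edges G|)%N.
Proof.
apply: leq_trans (card_adj_le s); rewrite -sum1dep_card.
have -> : size l = (\sum_(i < size l) 1)%N by rewrite sum_nat_const card_ord muln1.
rewrite (sum_item s _ xpredT (fun=> 1%N)).
by rewrite (eq_bigl (fun p : 'I_n * 'I_n => adj G p.1 p.2)) // => p; rewrite andbT.
Qed.

(** A crude bound, since each fan lies among the stream positions; it suffices to keep the space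
    bound away from 0. *)
Lemma triangles_le : (#|triangles G| <= (2 * #|edges G|) ^ 2)%N.
Proof.
apply: (@leq_trans (size l * size l)); last by rewrite -mulnn leq_mul ?size_items_le.
rewrite -(sum_tri_between s).
rewrite -(sum_item s _ (fun p => before s p.1 p.2) (fun p => tri_between s p.1 p.2)).
rewrite big_mkcond -[X in (_ <= X * _)%N]card_ord -sum_nat_const.
apply: leq_sum => i _; case: ifP => // _; rewrite -/(item_R i) -card_item_fan.
by rewrite -[X in (_ <= X)%N](card_ord (size l)) max_card.
Qed.

(** Markov's inequality on the [edge_R]: they sum to [2 T] over the items because each edge appears
    twice. *)
Lemma heavies_le : heavies * tau <= 2 * T.
Proof.
have sumE : (\sum_i edge_R s (item (s := s) i).1 (item i).2 =
             2 * #|triangles G|)%N.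
  rewrite (sum_item s _ xpredT (fun p => edge_R s p.1 p.2)).
  rewrite (eq_bigl (fun p : 'I_n * 'I_n => adj G p.1 p.2)) => [|p]; last first.
    by rewrite andbT.
  rewrite (sum_adj_oriented s) -(sum_tri_between s) mul2n -addnn.
  congr (_ + _)%N; apply: eq_bigr => p /andP[adj_p before_p].
    by rewrite /edge_R before_p.
  by rewrite /= -(edge_R_sym adj_p) /edge_R before_p.
rewrite /T -natrM -sumE /heavies mulrC -sum1dep_card natr_sum mulr_sumr.
rewrite natr_sum [leRHS](bigID (fun i => O (item i).1 (item i).2)) /=.
rewrite -[leLHS]addr0; apply: lerD; last by apply: sumr_ge0.
by apply: ler_sum => i; rewrite mulr1 oracleP ?adj_item.
Qed.

Hypotheses (T_gt0 : 0 < T) (tau2_gt0 : 0 < tau2).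
Hypotheses (eta_gt0 : 0 < eta) (eta_le : eta <= 1 / 2).
Hypothesis light_var : tau * (p3^-1 - 1) <= eta ^+ 2 * T.
Hypothesis aux_var : p3^-1 - 1 <= eta ^+ 2 * tau2 / 2.
Hypothesis medium_var : 2 * tau2 * (p2^-1 - 1) <= eta ^+ 2 * T.
Hypotheses (X_gt0 : 0 < X) (X_ge : 10 * (N * p3 + heavies * p2) <= X).

Let I := 'I_(size l).
Let est := estimate p2 p3 tau2 (light_item (s := s) O) (heavy_item (s := s) O)
  (item_R (s := s)) (item_fan (s := s)).

Definition kept_count (x y : {ffun I -> bool}) : nat :=
  \sum_(i : I) kept (O (item i).1 (item i).2) (x i, y i).

Lemma sum_item_R :
  T = \sum_(i | light_item O i) (item_R (s := s) i)%:R +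
      \sum_(i | heavy_item O i) (item_R (s := s) i)%:R.
Proof.
rewrite /T -(sum_tri_between s).
rewrite -(sum_item s _ (fun p => before s p.1 p.2) (fun p => tri_between s p.1 p.2)).
rewrite natr_sum (bigID (fun i => O (item i).1 (item i).2)) /= addrC.
by [].
Qed.

Lemma expected_error :
  bexp p3 (fun y => bexp p2 (fun x => `|est x y - T|)) <= 4 * eta * T.
Proof.
have TE := sum_item_R; rewrite TE.
apply: (@estimate_error R I p2 p3 tau tau2 eta) => //; rewrite -?TE //.
- by move=> i _; apply: card_item_fan.
- move=> i /andP[bi nO]; have := oracleP (adj_item i); rewrite (negPf nO).
  by rewrite /edge_R bi => /esym/negbT; rewrite -ltNge => /ltW.
Qed.

Lemma expected_kept :
  bexp p3 (fun y => bexp p2 (fun x => (kept_count x y)%:R)) <= X / 10.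
Proof.
apply: le_trans (_ : N * p3 + heavies * p2 <= _); last first.
  by have := X_ge; lra.
pose hv (i : I) := O (item i).1 (item i).2.
(* Union bound: an item is kept through its [p3] coin or, if heavy, through its [p2] coin. *)
apply: le_trans (_ : bexp p3 (fun y => bexp p2 (fun x =>
    \sum_(i : I) (y i)%:R + \sum_(i | hv i) (x i)%:R)) <= _).
  apply: bexp_le => // y; apply: bexp_le => // x.
  rewrite /kept_count natr_sum [X in _ + X]big_mkcond -big_split /=.
  apply: ler_sum => i _; rewrite /kept -/(hv i) /=.
  by case: (y i); case: (x i); case: (hv i); rewrite ?addr0 ?add0r ?lerDl ?ler01.
have coordE p (i : I) : bexp p (fun x : {ffun I -> bool} => (x i)%:R) = p :> R.
  by rewrite (bexp_coord p i (fun b => b%:R)) mulr1 mulr0 addr0.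
rewrite (@bexp_eq _ _ _ _ (fun y => \sum_(i : I) (y i)%:R + heavies * p2)) => [|y].
  rewrite bexpD bexp_cst bexp_sum lerD2r /N.
  under eq_bigr => i _ do rewrite coordE.
  by rewrite sumr_const card_ord mulr_natl.
rewrite bexpD bexp_cst bexp_sum; congr (_ + _).
under eq_bigr => i _ do rewrite coordE.
by rewrite sumr_const mulr_natl /heavies cardsE.
Qed.

Variables (h2 : 0 <= p2 <= 1) (h3 : 0 <= p3 <= 1).

Let A := @guarded_alg R n (n.+2 ^ 8) (5 + 10 * X) tau tau2 p2 p3 h2 h3.

Lemma count_kept (w : (size l).-tuple (bool * bool)) :
  count (kept_item O (coin_of w)) l = kept_count (xcoins w) (ycoins w).
Proof.
rewrite -sum1_count big_mkcond big_tnth /=; apply: eq_bigr => i _.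
rewrite -/(item i) /kept_item coin_item !ffunE -surjective_pairing.
by case: (kept _ _).
Qed.

(** The left side is the accumulator bound [M (M^2 + n M)] for a stream of at most [M = n^2] items.
    The base is at least 2, so a spare factor absorbs the sum. *)
Lemma word_bound : (n * n * (n * n * (n * n) + n * (n * n)) < n.+2 ^ 8)%N.
Proof.
set k := n.+2; have nk : (n <= k)%N by rewrite /k -addn2 leq_addr.
have h2' : (n * n <= k ^ 2)%N by rewrite -mulnn leq_mul.
have h3' : (n * (n * n) <= k ^ 4)%N.
  rewrite (@leq_trans (k ^ 3)) ?leq_exp2l //.
  by rewrite expnS leq_mul.
have h4 : (n * n * (n * n) <= k ^ 4)%N by rewrite -[4%N]/(2 + 2)%N expnD leq_mul.
have h5 : (n * n * (n * n) + n * (n * n) <= k ^ 5)%N.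
  apply: leq_trans (leq_add h4 h3') _.
  by rewrite addnn -mul2n expnS leq_mul2r orbC.
apply: (@leq_ltn_trans (k ^ 7)); last by rewrite ltn_exp2l.
by rewrite -[7%N]/(2 + 5)%N expnD leq_mul.
Qed.

Lemma fits_run (w : (size l).-tuple (bool * bool)) k :
  (kept_count (xcoins w) (ycoins w))%:R <= X ->
  fits (n.+2 ^ 8) (5 + 10 * X)
    (encode (run (big_hits p3 tau2) O (coin_of w) (start n) (take k l))).
Proof.
move=> le_X; apply/andP; split.
  have le_nn : (size (take k l) <= n * n)%N.
    rewrite size_take_min geq_min; apply/orP; right.
    rewrite -(card_uniqP (uniq_items s)) (leq_trans (max_card _)) //.
    by rewrite card_prod card_ord.
  have powW d : (d < 8 -> n.+2 ^ d < n.+2 ^ 8)%N by rewrite ltn_exp2l.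
  apply: words_small (small_run _ _ _ le_nn) _ _ _ _.
  - exact: (powW 0%N).
  - by apply: leq_ltn_trans (powW 1%N _); rewrite // expn1 -addn2 leq_addr.
  - apply: leq_ltn_trans le_nn (leq_ltn_trans _ (powW 2%N _)) => //.
    by rewrite -mulnn leq_mul // -addn2 leq_addr.
  - by apply: leq_ltn_trans word_bound; rewrite leq_mul2r le_nn orbT.
rewrite size_encode size_entries_run add0n natrD natrM lerD2l ler_pM2l //.
apply: le_trans le_X; rewrite ler_nat -count_kept.
rewrite -[X in (_ <= count _ X)%N](cat_take_drop k).
by rewrite count_cat leq_addr.
Qed.

Lemma result_estimate (w : (size l).-tuple (bool * bool)) :
  (kept_count (xcoins w) (ycoins w))%:R <= X ->
  @result R n A O l w = est (xcoins w) (ycoins w).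
Proof.
move=> le_X; rewrite guarded_result ?uniq_items //; last first.
  by move=> k; apply: fits_run.
rewrite take_size.
have [-> ->] := run_items (big_hits p3 tau2) (coin_of w) s oracle_sym.
by rewrite estimate_items.
Qed.

(** Two Markov bounds and a union bound at once: the indicator of success dominates [F], which is 1
    minus two penalties of mean at most 1/10 each. This gives 8/10. *)
Lemma success_probability (eps : R) : eps = 40 * eta ->
  7 / 10 <= prob (A := A) (fun w => `|@result R n A O l w - T| <= eps * T).
Proof.
move=> ->.
have e0 : 0 < 40 * eta * T by rewrite !mulr_gt0.
pose F x y := 1 + ((40 * eta * T)^-1 * - 1) * `|est x y - T|
                + (X^-1 * - 1) * (kept_count x y)%:R.
apply: le_trans (_ : bexp p3 (fun y => bexp p2 (fun x => F x y)) <= _); last first.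
  rewrite -sum_coin_tuples /prob [leRHS]big_mkcond /=; apply: ler_sum => w _.
  have W0 : 0 <= \prod_(r <- w) coin_weight p2 p3 r.
    by apply: prodr_ge0 => r _; apply: coin_weight_ge0.
  rewrite -/(xcoins w) -/(ycoins w) /F.
  have a0 : 0 <= (40 * eta * T)^-1 * `|est (xcoins w) (ycoins w) - T|.
    by rewrite mulr_ge0 // invr_ge0 ltW.
  have b0 : 0 <= X^-1 * (kept_count (xcoins w) (ycoins w))%:R.
    by rewrite mulr_ge0 // invr_ge0 ltW.
  case: ifP => [_|/negbT bad]; first by rewrite ler_piMr //; lra.
  rewrite mulr_ge0_le0 //.
  (* With more than [X] kept items the memory may overflow, but the second penalty is then at least
     1; otherwise the output is the estimate. *)
  have [le_X|gt_X] := leP (kept_count (xcoins w) (ycoins w))%:R X; last first.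
    suff : 1 <= X^-1 * (kept_count (xcoins w) (ycoins w))%:R by lra.
    by rewrite ler_pdivlMl // mulr1 ltW.
  have : ~~ (`|@result R n A O l w - T| <= 40 * eta * T) := bad.
  rewrite result_estimate // -ltNge => {}bad.
  suff : 1 <= (40 * eta * T)^-1 * `|est (xcoins w) (ycoins w) - T| by lra.
  by rewrite ler_pdivlMl // mulr1 ltW.
rewrite (@bexp_eq _ _ _ _ (fun y =>
    1 + ((40 * eta * T)^-1 * - 1) * bexp p2 (fun x => `|est x y - T|)
    + (X^-1 * - 1) * bexp p2 (fun x => (kept_count x y)%:R))) => [|y]; last first.
  rewrite bexpD (bexpD _ (fun=> 1)) bexp_cst.
  by rewrite (bexpZ _ _ (fun x => `|est x y - T|))
    (bexpZ _ _ (fun x => (kept_count x y)%:R)).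
rewrite bexpD (bexpD _ (fun=> 1)) bexp_cst.
rewrite (bexpZ _ _ (fun y => bexp p2 (fun x => `|est x y - T|))).
rewrite (bexpZ _ _ (fun y => bexp p2 (fun x => (kept_count x y)%:R))).
have hE : (40 * eta * T)^-1 *
    bexp p3 (fun y => bexp p2 (fun x => `|est x y - T|)) <= 1 / 10.
  rewrite ler_pdivrMl //; apply: le_trans expected_error _; lra.
have hK : X^-1 * bexp p3 (fun y => bexp p2 (fun x => (kept_count x y)%:R)) <= 1 / 10.
  by rewrite ler_pdivrMl //; apply: le_trans expected_kept _; lra.
lra.
Qed.

End Success.

(** * Choice of the parameters *)

Section Tuning.
Variable R : realType.
Implicit Types (q t eta m x : R).

(** The lower cut makes it a probability for every input, so that the algorithm is defined for
    arbitrary parameters. *)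
Definition clip x : R := Num.max 0 (Num.min 1 x).

Lemma clip_in01 x : 0 <= clip x <= 1.
Proof. by rewrite /clip le_max lexx ge_max ler01 ge_min lexx. Qed.

Lemma clipE x : 0 < x -> clip x = Num.min 1 x.
Proof. by move=> x0; apply/max_idPr; rewrite le_min ler01 ltW. Qed.

Lemma clip_gt0 x : 0 < x -> 0 < clip x.
Proof. by move=> x0; rewrite clipE // lt_min ltr01. Qed.

Lemma clip_le x : 0 < x -> clip x <= x.
Proof. by move=> x0; rewrite clipE // ge_min lexx orbT. Qed.

(** Clipping costs nothing: at rate 1 the variance factor is 0. *)
Lemma clipV x : 0 < x -> (clip x)^-1 - 1 <= x^-1.
Proof.
move=> x0; rewrite clipE // /Num.min; case: ifP => _.
  by rewrite invr1 subrr invr_ge0 ltW.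
by rewrite lerBlDr lerDl.
Qed.

Definition sample_size (m t eta : R) : R :=
  Num.min (2 * eta ^- 2 * (m `^ (2 / 3) / t `^ (1 / 3))) (eta^-1 * m `^ (1 / 2)).

Lemma powR_frac (x : R) (a d : nat) : 0 <= x -> (0 < d)%N ->
  (x `^ (a%:R / d%:R)) ^+ d = x ^+ a.
Proof.
move=> x0 d0; rewrite -powR_mulrn ?powR_ge0 // -powRrM divfK ?powR_mulrn //.
by rewrite pnatr_eq0 -lt0n.
Qed.

Lemma sample_size_gt0 m t eta : 0 < m -> 0 < t -> 0 < eta -> 0 < sample_size m t eta.
Proof.
move=> m0 t0 e0; rewrite lt_min; apply/andP; split.
  by rewrite !mulr_gt0 ?invr_gt0 ?exprn_gt0 ?powR_gt0.
by rewrite mulr_gt0 ?invr_gt0 ?powR_gt0.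
Qed.

(** Each disjunct holds with equality for the corresponding term of the minimum. In the first, the
    rate [p2] becomes 1. *)
Lemma sample_size_cases m t eta : 0 < m -> 0 < t -> 0 < eta ->
  let q := sample_size m t eta in
  m <= eta ^+ 2 * q ^+ 2 \/ 8 * m ^+ 2 <= eta ^+ 6 * q ^+ 3 * t.
Proof.
move=> m0 t0 e0; rewrite /sample_size /Num.min; case: ifP => _; [right|left].
  have u3 := powR_frac 2 (ltW m0) (isT : (0 < 3)%N).
  have g3 := powR_frac 1 (ltW t0) (isT : (0 < 3)%N).
  have g0 : 0 < t `^ (1 / 3) by rewrite powR_gt0.
  move: u3 g3 g0; set u := m `^ _; set g := t `^ _ => u3 g3 g0.
  rewrite -[t in leRHS]expr1 -g3 -u3 le_eqVlt; apply/orP; left; apply/eqP.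
  by field; rewrite !gt_eqF.
have h2 := powR_frac 1 (ltW m0) (isT : (0 < 2)%N).
move: h2; set h := m `^ _ => h2.
have -> : eta ^+ 2 * (eta^-1 * h) ^+ 2 = h ^+ 2 by field; rewrite gt_eqF.
by rewrite h2 expr1.
Qed.

Lemma cube_le x (y : R) : 0 <= y -> x ^+ 3 <= y ^+ 3 -> x <= y.
Proof.
move=> y0 le3; rewrite leNgt; apply/negP => lt_yx.
have : y ^+ 3 < x ^+ 3 by rewrite ltrXn2r // ltW // (le_lt_trans y0).
by rewrite ltNge le3.
Qed.

(** The factor 3200 is [2 * 40^2]. Replacing [t] by [T] costs a cube root of [c^2], bounded crudely
    by [c^2]. *)
Lemma sample_size_le (c eps : R) (m T : nat) t : 1 <= c -> 0 < eps ->
  (0 < T)%N -> 0 < t -> T%:R <= c ^+ 2 * t ->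
  sample_size m%:R t (eps / 40) <= 3200 * c ^+ 2 * space_bound eps m T.
Proof.
move=> c1 e0 T0 t0 leT; rewrite /space_bound (gtn_eqF T0).
have c21 : 1 <= c ^+ 2 by rewrite exprn_ege1.
rewrite minr_pMr; last by lra.
rewrite /sample_size le_min !ge_min; apply/andP; split; apply/orP; [left|right].
  have G3 := powR_frac 1 (ler0n R T) (isT : (0 < 3)%N).
  have g3 := powR_frac 1 (ltW t0) (isT : (0 < 3)%N).
  have g0 : 0 < t `^ (1 / 3) by rewrite powR_gt0.
  have G0 : 0 < T%:R `^ (1 / 3) :> R by rewrite powR_gt0 ?ltr0n.
  have u0 : 0 <= m%:R `^ (2 / 3) :> R by exact: powR_ge0.
  move: G3 g3 g0 G0 u0; set u := m%:R `^ _; set g := t `^ _; set Gm := _ `^ _.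
  rewrite !expr1 => G3 g3 g0 G0 u0.
  have leG : Gm <= c ^+ 2 * g.
    apply: cube_le; first by rewrite mulr_ge0 ?ltW //; lra.
    rewrite G3 (le_trans leT) // exprMn g3; apply: ler_wpM2r; first exact: ltW.
    by rewrite -exprM ler_weXn2l.
  have -> : 2 * (eps / 40) ^- 2 * (u / g) = 3200 * eps ^- 2 * u * g^-1.
    by field; rewrite !gt_eqF.
  have -> : 3200 * c ^+ 2 * (eps ^- 2 * (u / Gm)) =
      3200 * eps ^- 2 * u * (c ^+ 2 / Gm).
    by field; rewrite !gt_eqF.
  apply: ler_wpM2l; first by rewrite !mulr_ge0 // invr_ge0 exprn_ge0 // ltW.
  by rewrite ler_pdivlMr // mulrC ler_pdivrMr.
have h0 : 0 <= m%:R `^ (1 / 2) :> R by exact: powR_ge0.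
move: h0; set h := _ `^ _ => h0.
have -> : (eps / 40)^-1 * h = 40 * (eps^-1 * h) by field; rewrite gt_eqF.
apply: ler_wpM2r; first by rewrite mulr_ge0 // invr_ge0 ltW.
lra.
Qed.

(** Needed to absorb the five header words into a bound with no additive constant. *)
Lemma space_bound_ge (eps : R) (m T : nat) : 0 < eps -> eps < 1 ->
  (0 < T)%N -> (T <= (2 * m) ^ 2)%N -> 1 <= 4 * space_bound eps m T.
Proof.
move=> e0 e1 T0 leT; rewrite /space_bound (gtn_eqF T0).
have m0 : (0 < m)%N by case: m leT => //; rewrite muln0 leqNgt T0.
have eV : 1 <= eps^-1 by rewrite invf_ge1 // ltW.
rewrite minr_pMr // le_min; apply/andP; split.
  have G3 := powR_frac 1 (ler0n R T) (isT : (0 < 3)%N).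
  have u3 := powR_frac 2 (ler0n R m) (isT : (0 < 3)%N).
  have G0 : 0 < T%:R `^ (1 / 3) :> R by rewrite powR_gt0 ?ltr0n.
  have u0 : 0 <= m%:R `^ (2 / 3) :> R by exact: powR_ge0.
  move: G3 u3 G0 u0; set u := m%:R `^ _; set Gm := _ `^ _.
  rewrite expr1 => G3 u3 G0 u0.
  have leG : Gm <= 4 * u.
    apply: cube_le; first by rewrite mulr_ge0.
    rewrite G3 exprMn u3; apply: le_trans (_ : ((2 * m) ^ 2)%:R <= _).
      by rewrite ler_nat.
    rewrite natrX natrM exprMn; apply: ler_wpM2r; first by rewrite exprn_ge0.
    lra.
  have : 1 <= 4 * (u / Gm) by rewrite mulrA ler_pdivlMr // mul1r.
  move=> h; apply: le_trans h _; apply: ler_wpM2l => //.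
  rewrite ler_peMl ?divr_ge0 ?(ltW G0) // -exprVn exprn_ege1 //.
have h1 : 1 <= m%:R `^ (1 / 2) :> R.
  by rewrite -[leLHS](powRr0 (m%:R : R)) ler_powR ?ler1n // divr_ge0.
have := ler_pM ler01 ler01 eV h1; lra.
Qed.

Section Conditions.
Variables m t T eta q : R.
Hypotheses (m0 : 0 < m) (t0 : 0 < t) (eta0 : 0 < eta) (q0 : 0 < q).
Hypothesis q_cases : m <= eta ^+ 2 * q ^+ 2 \/ 8 * m ^+ 2 <= eta ^+ 6 * q ^+ 3 * t.

Let p2 := clip (eta ^+ 2 * q ^+ 2 / m).
Let p3 := clip (q / m).
Let tau := eta ^+ 2 * t * q / m.
Let tau2 := 2 * m / (q * eta ^+ 2).

Let x2_gt0 : 0 < eta ^+ 2 * q ^+ 2 / m.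
Proof. by rewrite !mulr_gt0 ?invr_gt0 ?exprn_gt0. Qed.

Let x3_gt0 : 0 < q / m.
Proof. by rewrite divr_gt0. Qed.

Lemma tau2_gt0 : 0 < tau2.
Proof. by apply: divr_gt0; apply: mulr_gt0; rewrite ?ltr0n // exprn_gt0. Qed.

(** [tau] is tuned so that [tau * m / q] is exactly [eta^2 t]; likewise, in the next lemma, [m / q]
    is exactly [eta^2 tau2 / 2]. *)
Lemma light_condition : t <= T -> tau * (p3^-1 - 1) <= eta ^+ 2 * T.
Proof.
move=> tT; have tau0 : 0 <= tau.
  by rewrite !mulr_ge0 ?exprn_ge0 ?invr_ge0 // ltW.
apply: le_trans (ler_wpM2l tau0 (clipV x3_gt0)) _.
have -> : tau * (q / m)^-1 = eta ^+ 2 * t by rewrite /tau; field; rewrite !gt_eqF.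
by apply: ler_wpM2l; rewrite ?exprn_ge0 // ltW.
Qed.

Lemma aux_condition : p3^-1 - 1 <= eta ^+ 2 * tau2 / 2.
Proof.
apply: le_trans (clipV x3_gt0) _; rewrite le_eqVlt; apply/orP; left; apply/eqP.
by rewrite /tau2; field; rewrite !gt_eqF.
Qed.

(** Either [p2 = 1] and the variance vanishes, or the bound reduces to [4 m^2 <= eta^6 q^3 t]. *)
Lemma medium_condition : t <= T -> 2 * tau2 * (p2^-1 - 1) <= eta ^+ 2 * T.
Proof.
move=> tT; have e2 : 0 <= eta ^+ 2 by rewrite exprn_ge0 // ltW.
have rhs : eta ^+ 2 * t <= eta ^+ 2 * T by apply: ler_wpM2l.
case: q_cases => q_large.
  have -> : p2 = 1 by rewrite /p2 clipE // min_l // ler_pdivlMr // mul1r.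
  by rewrite invr1 subrr mulr0 (le_trans _ rhs) // mulr_ge0 // ltW.
have t20 : 0 <= 2 * tau2 by apply: mulr_ge0; [exact: ler0n | exact/ltW/tau2_gt0].
apply: le_trans (ler_wpM2l t20 (clipV x2_gt0)) (le_trans _ rhs).
have -> : 2 * tau2 * (eta ^+ 2 * q ^+ 2 / m)^-1 = 4 * m ^+ 2 / (eta ^+ 4 * q ^+ 3).
  by rewrite /tau2; field; rewrite !gt_eqF.
rewrite ler_pdivrMr ?mulr_gt0 ?exprn_gt0 //.
have -> : eta ^+ 2 * t * (eta ^+ 4 * q ^+ 3) = eta ^+ 6 * q ^+ 3 * t by ring.
by apply: le_trans q_large; have := sqr_ge0 m; lra.
Qed.

(** The unclipped [p2] equals [tau * q / t], so the bound on [h * tau] leaves at most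
    [2 (T / t) q <= 2 c^2 q] sampled heavy items on average. *)
Lemma budget_condition (c N h : R) : 0 <= N -> N <= 2 * m -> 0 <= h ->
  h * tau <= 2 * T -> T <= c ^+ 2 * t ->
  10 * (N * p3 + h * p2) <= 20 * (1 + c ^+ 2) * q.
Proof.
move=> N0 leN h0 le_h leT.
have size_p3 : N * p3 <= 2 * q.
  apply: le_trans (_ : 2 * m * (q / m) <= _).
    by apply: ler_pM => //; [rewrite ltW // clip_gt0 | exact: clip_le].
  by rewrite le_eqVlt; apply/orP; left; apply/eqP; field; rewrite gt_eqF.
have heavy_p2 : h * p2 <= 2 * c ^+ 2 * q.
  apply: le_trans (ler_wpM2l h0 (clip_le x2_gt0)) _.
  have -> : h * (eta ^+ 2 * q ^+ 2 / m) = h * tau * (q / t).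
    by rewrite /tau; field; rewrite !gt_eqF.
  apply: le_trans (ler_wpM2r (ltW (divr_gt0 q0 t0)) le_h) _.
  have leTq := ler_wpM2r (ltW q0) leT.
  by rewrite mulrA ler_pdivrMr //; lra.
lra.
Qed.

End Conditions.
End Tuning.

(** * Assembling the algorithm *)

Lemma unit_law_sum1 (R : realType) : \sum_(r : unit) (1 : R) = 1.
Proof. by rewrite sumr_const card_unit. Qed.

Definition idle_alg (R : realType) (n : nat) : oracle_streaming_alg R n :=
  @OracleStreamingAlg R n 0 unit (fun=> 1) (fun=> ler01) (unit_law_sum1 R) [::]
    (fun _ _ _ _ => [::]) (fun=> 0).

Definition triangle_alg (R : realType) (c : R) (n m : nat) (eps T0 : R) :
    oracle_streaming_alg R n :=
  if T0 <= 0 then idle_alg R n else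
  let eta := eps / 40 in
  let t := T0 / c in
  let q := sample_size m%:R t eta in
  @guarded_alg R n (n.+2 ^ 8) (5 + 10 * (20 * (1 + c ^+ 2) * q))
    (eta ^+ 2 * t * q / m%:R) (2 * m%:R / (q * eta ^+ 2))
    (clip (eta ^+ 2 * q ^+ 2 / m%:R)) (clip (q / m%:R))
    (clip_in01 _) (clip_in01 _).

Lemma idle_correct (R : realType) (n : nat) (O : rel 'I_n) l W (S e : R) :
  0 <= S -> runs_in_space (idle_alg R n) O l W S /\
  7 / 10 <= prob (fun w : (size l).-tuple (coin (idle_alg R n)) =>
               `|result O w - 0| <= e * 0).
Proof.
move=> S0; split=> [w st|].
  rewrite /memories in_cons => /orP[/eqP->//|].
  have : all (pred1 [::]) (scanl (item_step (A := idle_alg R n) O) [::] (zip l w)).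
    by elim: (zip l w) => //= x xs ->; rewrite eqxx.
  by move=> /allP h /h /eqP->.
rewrite /prob (eq_bigl xpredT) => [|w]; last first.
  by rewrite /result subrr normr0 mulr0 lexx.
rewrite (eq_bigr (fun=> 1)) => [|w _]; last by rewrite big1.
rewrite sumr_const card_tuple card_unit exp1n; lra.
Qed.

Theorem theorem1p1 (R : realType) (c : R) (hc : 1 <= c) :
  exists (alg : forall (n m : nat) (eps T0 : R), oracle_streaming_alg R n)
         (C : R) (k b : nat),
  forall (n : nat) (G : sgraph n) (s : adj_stream G) (eps T0 : R)
         (O : rel 'I_n),
    let m := #|edges G| in
    let T := #|triangles G| in
    let A := alg n m eps T0 in
    0 < eps -> eps < 1 ->
    T%:R / c <= T0 -> T0 <= c * T%:R ->
    perfect_heavy_oracle s (threshold A) O ->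
    runs_in_space A O (items s) (n.+2 ^ b)
      (soft_O C k n (space_bound eps m T)) /\
    7 / 10 <= prob (fun w : (size (items s)).-tuple (coin A) =>
                 `|result O w - T%:R| <= eps * T%:R).
Proof.
(* With [f] the space bound, the budget is [5 + 200 (1 + c^2) q], where [5 <= 20 f] and
   [q <= 3200 c^2 f]. The exponent 0 means that no logarithm is spent. *)
exists (triangle_alg c), (20 + 200 * 3200 * (1 + c ^+ 2) * c ^+ 2), 0%N, 8%N.
move=> n G s eps T0 O m T A e0 e1 geT0 leT0; rewrite {}/A /triangle_alg.
have c0 : 0 < c by lra.
rewrite /soft_O expr0 mulr1.
have C0 : 0 <= 20 + 200 * 3200 * (1 + c ^+ 2) * c ^+ 2.
  have c2 : 0 <= c ^+ 2 by rewrite exprn_ge0 ?ltW.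
  apply: addr_ge0; first exact: ler0n.
  apply: (mulr_ge0 _ c2); apply: mulr_ge0; last by lra.
  by apply: mulr_ge0; apply: ler0n.
(* A nonpositive [T0] forces [T = 0], and the idle algorithm is then exact. *)
have [T0le|T0gt] := leP T0 0 => oracleP.
  have T_eq0 : T = 0%N.
    apply/eqP; rewrite -leqn0 -(ler_nat R).
    by rewrite -(pmulr_lle0 _ (_ : 0 < c^-1)) ?invr_gt0 // (le_trans geT0).
  rewrite T_eq0; apply: idle_correct; rewrite mulr_ge0 // /space_bound eqxx.
  by rewrite mulr_ge0 ?powR_ge0 // invr_ge0 ltW.
have T_gt0 : (0 < T)%N.
  by rewrite -(ltr_nat R) -(pmulr_rgt0 _ c0) (lt_le_trans T0gt).
have leTm : (T <= (2 * m) ^ 2)%N by apply: triangles_le s.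
have m_gt0 : (0 < m)%N.
  by rewrite lt0n; apply: contraTneq leTm => ->; rewrite -ltnNge.
have m0 : 0 < m%:R :> R by rewrite ltr0n.
have TR0 : 0 < T%:R :> R by rewrite ltr0n.
set eta := eps / 40; set t := T0 / c; set q := sample_size _ _ _.
have t0 : 0 < t by rewrite divr_gt0.
have tT : t <= T%:R by rewrite ler_pdivrMr // mulrC.
have Tt : T%:R <= c ^+ 2 * t.
  rewrite /t (_ : _ * _ = T0 * c); last by field; rewrite gt_eqF.
  by rewrite -ler_pdivrMr.
have eta0 : 0 < eta by rewrite divr_gt0.
have q0 : 0 < q by apply: sample_size_gt0.
have q_cases := sample_size_cases m0 t0 eta0; rewrite -/q /= in q_cases.
set X := 20 * (1 + c ^+ 2) * q.
have c2 : 0 <= c ^+ 2 by rewrite exprn_ge0 ?ltW.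
have X0 : 0 < X by apply: (mulr_gt0 _ q0); lra.
split.
  have cap0 : 0 <= 5 + 10 * X by lra.
  move=> w st st_in; have [all_W le_cap] := guarded_space cap0 st_in; split=> //.
  apply: le_trans le_cap _.
  have := sample_size_le m hc e0 T_gt0 t0 Tt.
  have := space_bound_ge e0 e1 T_gt0 leTm.
  rewrite -/q /X; set f := space_bound _ _ _ => f1 qf.
  have : 200 * (1 + c ^+ 2) * q <= 200 * (1 + c ^+ 2) * (3200 * c ^+ 2 * f).
    by apply: ler_wpM2l qf; lra.
  by move=> le_q; lra.
apply: (@success_probability R n G s _ _ _ _ eta X O) => //.
- by apply: clip_gt0; rewrite !mulr_gt0 ?invr_gt0 ?exprn_gt0.
- by have /andP[] := clip_in01 (eta ^+ 2 * q ^+ 2 / m%:R).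
- by apply: clip_gt0; rewrite divr_gt0.
- by have /andP[] := clip_in01 (q / m%:R).
- exact: tau2_gt0.
- by rewrite /eta; lra.
- exact: light_condition.
- exact: aux_condition.
- exact: (@medium_condition _ _ t).
- apply: (@budget_condition _ _ t T%:R) => //.
    by rewrite -natrM ler_nat size_items_le.
  exact: heavies_le.
- by rewrite /eta; field.
Qed.
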